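(* Let $q$ be a non-zero complex number which is not a root of unity, let $U^+=U_q^+(B_2)$, and let the torus $\mathcal{H}=(\mathbb{C}^* )^2$ act on $U^+$ by automorphisms via $(h_1,h_2).e_i=h_ie_i$ for $i\in\{1,2\}$. Then $$\mathrm{Spec}_{\langle z'\rangle}(U^+)=\{\langle z'\rangle\}\cup\{\langle z-\alpha,z'\rangle\mid\alpha\in\mathbb{C}^*\}.$$ Further, for all $\alpha\in\mathbb{C}^*$, the prime ideal $\langle z-\alpha,z'\rangle$ has height $2$.
   Context: $U^+=U_q^+(B_2)$ is the unital associative $\mathbb{C}$-algebra generated by $e_1,e_2$ subject to the quantum Serre relations $e_1^2e_2-(q^2+q^{-2})e_1e_2e_1+e_2e_1^2=0$ and $e_2^3e_1-(q^2+1+q^{-2})e_2^2e_1e_2+(q^2+1+q^{-2})e_2e_1e_2^2-e_1e_2^3=0$. Set $e_3=e_1e_2-q^2e_2e_1$, $\overline{e_3}=e_1e_2-q^{-2}e_2e_1$, $z=e_2e_3-q^2e_3e_2$ and $z'=(1-q^{-2})\left(e_3\overline{e_3}+(1+q^{-2})ze_1\right)$; the center of $U^+$ is the polynomial ring $\mathbb{C}[z,z']$. $\langle\cdots\rangle$ denotes the two-sided ideal of $U^+$ generated by the listed elements. $\mathrm{Spec}(U^+)$ is the set of prime ideals of $U^+$. For a prime ideal $J$ that is $\mathcal{H}$-invariant (i.e. $h.J=J$ for all $h\in\mathcal{H}$; $\langle z'\rangle$ is such an ideal), the $\mathcal{H}$-stratum is $\mathrm{Spec}_J(U^+)=\{P\in\mathrm{Spec}(U^+)\mid\bigcap_{h\in\mathcal{H}}h.P=J\}$.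 *)

(* Defs.v *)
From HB Require Import structures.
From mathcomp Require Import all_boot all_order all_algebra.
From mathcomp Require Import boolp classical_sets reals.
From mathcomp Require Import complex.
From mathcomp Require Import ring.
(* The notations of these two files clash with those of classical_sets. *)
From mathcomp Require Import -(notations) finmap.
From mathcomp Require Import -(notations) monalg.

Set Implicit Arguments.
Unset Strict Implicit.
Unset Printing Implicit Defensive.

Import GRing.Theory.
Local Open Scope ring_scope.
Local Open Scope classical_set_scope.
Local Open Scope quotient_scope.

Section Ideals.
Variable A : nzRingType.
Implicit Types (I J P S : set A).

Definition two_sided_ideal I : Prop :=
  [/\ I 0, forall x y, I x -> I y -> I (x + y)
         & forall a x b, I x -> I (a * x * b)].

Definition ideal_gen S : set A := smallest two_sided_ideal S.

Lemma ideal_gen_ideal S : two_sided_ideal (ideal_gen S).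
Proof.
split=> [J [[]]//|x y Sx Sy J JS|a x b Sx J JS].
  by have [[_ JD _] _] := JS; apply: JD; [exact: Sx|exact: Sy].
by have [[_ _ JM] _] := JS; apply: JM; exact: Sx.
Qed.

Lemma two_sided_idealN I x : two_sided_ideal I -> I x -> I (- x).
Proof. by case=> _ _ IM /(IM (-1) _ 1); rewrite mulr1 mulN1r. Qed.

(* As P is closed under sums, the product ideal IJ lies in P if and only if
   all products x * y, with x in I and y in J, do. *)
Definition prime_ideal P : Prop :=
  [/\ two_sided_ideal P, P <> [set: A]
    & forall I J, two_sided_ideal I -> two_sided_ideal J ->
        [set x * y | x in I & y in J] `<=` P -> I `<=` P \/ J `<=` P].

Definition Spec : set (set A) := [set P | prime_ideal P].

(* c 0 < c 1 < ... < c n = P; the values of c beyond n are irrelevant. *)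
Definition prime_chain P (n : nat) (c : nat -> set A) : Prop :=
  [/\ forall i, (i <= n)%N -> prime_ideal (c i),
      forall i, (i < n)%N -> c i `<` c i.+1
    & c n = P].

Definition has_height P (n : nat) : Prop :=
  (exists c, prime_chain P n c) /\
  (forall m c, prime_chain P m c -> (m <= n)%N).

End Ideals.

Arguments Spec A : clear implicits.

Section FreeAlgebra.
Variable K : fieldType.

Definition free_alg2 : Type := malg (fmonom 'I_2) K.

HB.instance Definition _ := GRing.Lalgebra.copy free_alg2 (malg (fmonom 'I_2) K).

Definition free_gen (i : 'I_2) : free_alg2 := mkmalgU (fmu i) 1.

Section Eval.
Variables (A : algType K) (b : 'I_2 -> A).

Definition monom_eval (m : fmonom 'I_2) : A :=
  \prod_(i <- fmonom_val m) b i.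

Lemma monom_eval_multiplicative : mmorphism monom_eval.
Proof.
split=> [x y|]; rewrite /monom_eval; last first.
  by rewrite [mone]fmoneE big_nil.
by rewrite [mmul _ _]fmmulE big_cat.
Qed.

HB.instance Definition _ :=
  monalg.isMultiplicative.Build _ _ monom_eval monom_eval_multiplicative.

Definition free_eval (p : free_alg2) : A := mmap (in_alg A) monom_eval p.

Lemma free_eval_zmod : zmod_morphism free_eval.
Proof. exact: mmap_is_additive. Qed.

Lemma free_eval_monoid : monoid_morphism free_eval.
Proof.
have c (g : free_alg2) m m' :
    GRing.comm (in_alg A (mcoeff m g)) (monom_eval m').
  by rewrite /GRing.comm /= mulr_algl mulr_algr.
by have [fM f1] := commr_mmap_is_multiplicative c; split.
Qed.

Lemma free_eval_scalable : scalable free_eval.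
Proof. by move=> k p; rewrite /free_eval mmapZ /= mulr_algl. Qed.

HB.instance Definition _ :=
  GRing.isZmodMorphism.Build free_alg2 A free_eval free_eval_zmod.
HB.instance Definition _ :=
  GRing.isMonoidMorphism.Build free_alg2 A free_eval free_eval_monoid.
HB.instance Definition _ :=
  GRing.isScalable.Build K free_alg2 A *:%R free_eval free_eval_scalable.

Lemma free_eval_gen i : free_eval (free_gen i) = b i.
Proof.
rewrite /free_eval /free_gen mmapU /= scale1r mul1r.
by rewrite /monom_eval [fmu i]fmuE big_seq1.
Qed.

End Eval.

Lemma free_alg2_scalerAr (k : K) (x y : free_alg2) :
  k *: (x * y) = x * (k *: y).
Proof.
apply/malgP => m.
rewrite (mcoeffMlw _ (@fsubset_refl _ _) (msuppZ_le k y)).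
rewrite mcoeffZ mcoeffMl mulr_sumr.
apply: eq_bigr => m1 _; rewrite mulr_sumr; apply: eq_bigr => m2 _.
by rewrite mcoeffZ mulrnAr mulrCA.
Qed.

HB.instance Definition _ :=
  GRing.Lalgebra_isAlgebra.Build K free_alg2 free_alg2_scalerAr.

Lemma free_monomE (m : fmonom 'I_2) :
  (mkmalgU m 1 : free_alg2) = \prod_(i <- fmonom_val m) free_gen i.
Proof.
case: m => s /=; elim: s => [|i s IHs].
  by rewrite big_nil -fmoneE.
rewrite big_cons -IHs /free_gen [RHS]malgM_def fgmulUU mulr1.
by congr (mkmalgU _ _); rewrite [RHS]fmmulE fmuE.
Qed.

Lemma free_evalP (A : algType K) (f : {lrmorphism free_alg2 -> A}) p :
  f p = free_eval (f \o free_gen) p.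
Proof.
rewrite {1}(monalgE p) raddf_sum; apply: eq_bigr => m _ /=.
have -> : (mkmalgU m (mcoeff m p) : free_alg2) = mcoeff m p *: mkmalgU m 1.
  by apply/malgP => m'; rewrite mcoeffZ !mcoeffU mulr_natr.
by rewrite linearZZ mulr_algl free_monomE rmorph_prod.
Qed.

End FreeAlgebra.

Section QuantumB2.
Variables (K : fieldType) (q : K).

Section SerreRelations.
Variables (A : algType K) (x y : A).

Definition serre12 : A :=
  x ^+ 2 * y - (q ^+ 2 + q ^- 2) *: (x * y * x) + y * x ^+ 2.

Definition serre21 : A :=
  y ^+ 3 * x - (q ^+ 2 + 1 + q ^- 2) *: (y ^+ 2 * x * y)
  + (q ^+ 2 + 1 + q ^- 2) *: (y * x * y ^+ 2) - x * y ^+ 3.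

End SerreRelations.

Lemma rmorph_serre12 (A B : algType K) (f : {lrmorphism A -> B}) x y :
  f (serre12 x y) = serre12 (f x) (f y).
Proof. by rewrite /serre12 linearD linearB linearZZ !rmorphM. Qed.

Lemma rmorph_serre21 (A B : algType K) (f : {lrmorphism A -> B}) x y :
  f (serre21 x y) = serre21 (f x) (f y).
Proof.
by rewrite /serre21 linearB linearD linearB !linearZZ !rmorphM.
Qed.

Let X1 : free_alg2 K := free_gen K ord0.
Let X2 : free_alg2 K := free_gen K ord_max.

Definition serre_ideal : {pred free_alg2 K} :=
  fun p => `[< ideal_gen [set serre12 X1 X2; serre21 X1 X2] p >].

Lemma serre_idealP p :
  (p \in serre_ideal) <-> ideal_gen [set serre12 X1 X2; serre21 X1 X2] p.
Proof. by split=> /asboolP. Qed.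

Lemma serre_ideal_zmod : zmod_closed serre_ideal.
Proof.
have sI := ideal_gen_ideal [set serre12 X1 X2; serre21 X1 X2].
have [I0 ID _] := sI.
split=> [|x y /serre_idealP Ix /serre_idealP Iy]; apply/serre_idealP => //.
exact: (ID _ _ Ix (two_sided_idealN sI Iy)).
Qed.

HB.instance Definition _ :=
  GRing.isZmodClosed.Build (free_alg2 K) serre_ideal serre_ideal_zmod.

Lemma serre_idealM a b p : p \in serre_ideal -> a * p * b \in serre_ideal.
Proof.
have [_ _ IM] := ideal_gen_ideal [set serre12 X1 X2; serre21 X1 X2].
by move=> /serre_idealP Ip; apply/serre_idealP; exact: (IM a p b Ip).
Qed.

Lemma serre_idealMl a p : p \in serre_ideal -> a * p \in serre_ideal.
Proof. by move=> /(serre_idealM a 1); rewrite mulr1. Qed.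

Lemma serre_idealMr b p : p \in serre_ideal -> p * b \in serre_ideal.
Proof. by move=> /(serre_idealM 1 b); rewrite mul1r. Qed.

Lemma serre_ideal_ker (A : algType K) (b : 'I_2 -> A) p :
  serre12 (b ord0) (b ord_max) = 0 -> serre21 (b ord0) (b ord_max) = 0 ->
  p \in serre_ideal -> free_eval b p = 0.
Proof.
move=> s12 s21 /serre_idealP Ip.
apply: (Ip [set p | free_eval b p = 0]); split.
  split=> [|x y /= x0 y0|a x c /= x0]; first exact: raddf0.
    by rewrite raddfD /= x0 y0 addr0.
  by rewrite !rmorphM /= x0 mulr0 mul0r.
by move=> _ [->|->] /=; [rewrite rmorph_serre12|rewrite rmorph_serre21];
  rewrite /= !free_eval_gen.
Qed.

(* The quotient of the free algebra on two generators by the two-sided ideal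
   generated by the quantum Serre relations. *)
Definition Uq : Type := Quotient.quot serre_ideal.

HB.instance Definition _ :=
  EqQuotient.copy Uq (Quotient.quot serre_ideal).
HB.instance Definition _ :=
  GRing.Zmodule.copy Uq (Quotient.quot serre_ideal).

Definition Uq_pi (p : free_alg2 K) : Uq := \pi_Uq p.

Local Notation pi := Uq_pi.

Lemma Uq_eqP (x y : free_alg2 K) :
  reflect (pi x = pi y) (x - y \in serre_ideal).
Proof. by rewrite Quotient.idealrBE; exact: eqP. Qed.

Lemma Uq_ind (P : Uq -> Prop) : (forall x, P (pi x)) -> forall u, P u.
Proof. by move=> Ppi u; rewrite -[u]reprK. Qed.

Lemma pi_zmod : zmod_morphism pi.
Proof. by move=> x y; rewrite /Uq_pi !piE. Qed.

HB.instance Definition _ := GRing.isZmodMorphism.Build (free_alg2 K) Uq pi pi_zmod.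

Lemma Uq_piK (u : Uq) : pi (repr u) = u.
Proof. exact: reprK. Qed.

Lemma repr_pi (x : free_alg2 K) : repr (pi x) - x \in serre_ideal.
Proof. by apply/Uq_eqP; rewrite Uq_piK. Qed.

Definition Uq_one : Uq := pi 1.

(* Locked, so that unification never unfolds the product and the scaling. *)
Fact Uq_key : unit. Proof. exact: tt. Qed.

Definition Uq_mul : Uq -> Uq -> Uq :=
  locked_with Uq_key (fun u v => pi (repr u * repr v)).

Definition Uq_scale : K -> Uq -> Uq :=
  locked_with Uq_key (fun k u => pi (k *: repr u)).

Lemma pi_mul x y : Uq_mul (pi x) (pi y) = pi (x * y).
Proof.
rewrite /Uq_mul unlock; apply/Uq_eqP; move: (repr_pi x) (repr_pi y).
move: (repr (pi x)) (repr (pi y)) => x' y' x'x y'y.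
have -> : x' * y' - x * y = (x' - x) * y' + x * (y' - y).
  by rewrite mulrBl mulrBr addrA subrK.
exact: rpredD (serre_idealMr y' x'x) (serre_idealMl x y'y).
Qed.

Lemma pi_scale k x : Uq_scale k (pi x) = pi (k *: x).
Proof.
rewrite /Uq_scale unlock; apply/Uq_eqP.
move: (repr_pi x); move: (repr (pi x)) => x' x'x.
by rewrite -scalerBr -mulr_algl serre_idealMl.
Qed.

Lemma Uq_mulA : associative Uq_mul.
Proof.
by elim/Uq_ind=> x; elim/Uq_ind=> y; elim/Uq_ind=> z; rewrite !pi_mul mulrA.
Qed.

Lemma Uq_mul1 : left_id Uq_one Uq_mul.
Proof. by elim/Uq_ind=> x; rewrite pi_mul mul1r. Qed.

Lemma Uq_1mul : right_id Uq_one Uq_mul.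
Proof. by elim/Uq_ind=> x; rewrite pi_mul mulr1. Qed.

Lemma Uq_mulDl : left_distributive Uq_mul +%R.
Proof.
elim/Uq_ind=> x; elim/Uq_ind=> y; elim/Uq_ind=> z.
by rewrite -raddfD !pi_mul mulrDl raddfD.
Qed.

Lemma Uq_mulDr : right_distributive Uq_mul +%R.
Proof.
elim/Uq_ind=> x; elim/Uq_ind=> y; elim/Uq_ind=> z.
by rewrite -raddfD !pi_mul mulrDr raddfD.
Qed.

Lemma Uq_one_neq0 : Uq_one != 0.
Proof.
apply/eqP; rewrite -(raddf0 pi) => /Uq_eqP; rewrite subr0.
move=> /(@serre_ideal_ker K^o (fun=> 0)) /=.
rewrite /serre12 /serre21 !expr0n /= !(mul0r, mulr0, scaler0, subr0, addr0).
by move=> /(_ erefl erefl); rewrite rmorph1 => /eqP; rewrite oner_eq0.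
Qed.

HB.instance Definition _ := GRing.Zmodule_isNzRing.Build Uq
  Uq_mulA Uq_mul1 Uq_1mul Uq_mulDl Uq_mulDr Uq_one_neq0.

Lemma pi_monoid : monoid_morphism pi.
Proof. by split=> [|x y]; [|exact: esym (pi_mul x y)]. Qed.

HB.instance Definition _ :=
  GRing.isMonoidMorphism.Build (free_alg2 K) Uq pi pi_monoid.

Lemma Uq_scaleA a b u : Uq_scale a (Uq_scale b u) = Uq_scale (a * b) u.
Proof. by elim/Uq_ind: u => x; rewrite !pi_scale scalerA. Qed.

Lemma Uq_scale1 : left_id 1 Uq_scale.
Proof. by elim/Uq_ind=> x; rewrite pi_scale scale1r. Qed.

Lemma Uq_scaleDr : right_distributive Uq_scale +%R.
Proof.
move=> k; elim/Uq_ind=> x; elim/Uq_ind=> y.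
by rewrite -raddfD !pi_scale scalerDr raddfD.
Qed.

Lemma Uq_scaleDl u : {morph Uq_scale^~ u : a b / a + b}.
Proof.
by move=> a b; elim/Uq_ind: u => x; rewrite !pi_scale scalerDl raddfD.
Qed.

HB.instance Definition _ := GRing.Zmodule_isLmodule.Build K Uq
  Uq_scaleA Uq_scale1 Uq_scaleDr Uq_scaleDl.

Lemma pi_scalable : scalable pi.
Proof. by move=> k x; exact: esym (pi_scale k x). Qed.

HB.instance Definition _ :=
  GRing.isScalable.Build K (free_alg2 K) Uq *:%R pi pi_scalable.

Lemma Uq_scaleAl (k : K) (u v : Uq) : k *: (u * v) = (k *: u) * v.
Proof.
elim/Uq_ind: u => x; elim/Uq_ind: v => y.
by rewrite -rmorphM -!pi_scalable -rmorphM scalerAl.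
Qed.

HB.instance Definition _ := GRing.Lmodule_isLalgebra.Build K Uq Uq_scaleAl.

Lemma Uq_scaleAr (k : K) (u v : Uq) : k *: (u * v) = u * (k *: v).
Proof.
elim/Uq_ind: u => x; elim/Uq_ind: v => y.
by rewrite -rmorphM -!pi_scalable -rmorphM scalerAr.
Qed.

HB.instance Definition _ := GRing.Lalgebra_isAlgebra.Build K Uq Uq_scaleAr.

Definition Uq_e1 : Uq := pi X1.
Definition Uq_e2 : Uq := pi X2.

Lemma Uq_serre12 : serre12 Uq_e1 Uq_e2 = 0.
Proof.
rewrite -(rmorph_serre12 pi X1 X2) -(raddf0 pi); apply/Uq_eqP; rewrite subr0.
by apply/serre_idealP; apply: sub_gen_smallest; left.
Qed.

Lemma Uq_serre21 : serre21 Uq_e1 Uq_e2 = 0.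
Proof.
rewrite -(rmorph_serre21 pi X1 X2) -(raddf0 pi); apply/Uq_eqP; rewrite subr0.
by apply/serre_idealP; apply: sub_gen_smallest; right.
Qed.

(* The algebra morphism out of Uq sending e1 to b1 and e2 to b2; meaningful
   only when b1 and b2 satisfy the quantum Serre relations. *)
Definition Uq_lift (A : algType K) (b1 b2 : A) (u : Uq) : A :=
  free_eval (fun i : 'I_2 => if i == ord0 then b1 else b2) (repr u).

Section Lift.
Variables (A : algType K) (b1 b2 : A).
Hypotheses (s12 : serre12 b1 b2 = 0) (s21 : serre21 b1 b2 = 0).

Let b (i : 'I_2) := if i == ord0 then b1 else b2.

Lemma Uq_lift_pi x : Uq_lift b1 b2 (pi x) = free_eval b x.
Proof.
apply/eqP; rewrite -subr_eq0 -raddfB; apply/eqP.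
exact: (serre_ideal_ker (b := b)) (repr_pi x).
Qed.

Lemma Uq_lift_zmod : zmod_morphism (Uq_lift b1 b2).
Proof.
by elim/Uq_ind=> x; elim/Uq_ind=> y; rewrite -raddfB !Uq_lift_pi raddfB.
Qed.

Lemma Uq_lift_monoid : monoid_morphism (Uq_lift b1 b2).
Proof.
split; first by rewrite -(rmorph1 pi) Uq_lift_pi rmorph1.
by elim/Uq_ind=> x; elim/Uq_ind=> y; rewrite -rmorphM !Uq_lift_pi rmorphM.
Qed.

Lemma Uq_lift_scalable : scalable (Uq_lift b1 b2).
Proof. by move=> k; elim/Uq_ind=> x; rewrite -linearZ !Uq_lift_pi linearZ. Qed.

Lemma Uq_lift_e1 : Uq_lift b1 b2 Uq_e1 = b1.
Proof. by rewrite Uq_lift_pi free_eval_gen. Qed.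

Lemma Uq_lift_e2 : Uq_lift b1 b2 Uq_e2 = b2.
Proof. by rewrite Uq_lift_pi free_eval_gen. Qed.

End Lift.

Lemma Uq_lift_unique (A : algType K) (f : {lrmorphism Uq -> A}) u :
  f u = Uq_lift (f Uq_e1) (f Uq_e2) u.
Proof.
rewrite -[in LHS](Uq_piK u) [LHS](free_evalP (f \o pi)) /Uq_lift /free_eval.
apply: eq_bigr => m _; congr (_ * _); apply: eq_bigr => i _ /=.
by case: eqP => [->//|/eqP i0]; congr (f (pi (free_gen _ _))); apply/val_inj;
  case: i i0 => [[|[|]]].
Qed.

Definition Uq_act (h : K * K) : Uq -> Uq :=
  Uq_lift (h.1 *: Uq_e1) (h.2 *: Uq_e2).

Lemma Uq_act_serre12 (h : K * K) : serre12 (h.1 *: Uq_e1) (h.2 *: Uq_e2) = 0.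
Proof.
rewrite -(scaler0 _ (h.1 ^+ 2 * h.2)) -Uq_serre12 /serre12.
rewrite !(scalerDr, scalerN, exprZn) -!scalerAl -!scalerAr -!scalerAl !scalerA.
by congr (_ *: _ - _ *: _ + _ *: _); ring.
Qed.

Lemma Uq_act_serre21 (h : K * K) : serre21 (h.1 *: Uq_e1) (h.2 *: Uq_e2) = 0.
Proof.
rewrite -(scaler0 _ (h.1 * h.2 ^+ 3)) -Uq_serre21 /serre21.
rewrite !(scalerDr, scalerN, exprZn) -!scalerAl -!scalerAr -!scalerAl.
rewrite !scalerA.
by congr (_ *: _ - _ *: _ + _ *: _ - _ *: _); ring.
Qed.

HB.instance Definition _ h := GRing.isZmodMorphism.Build Uq Uq (Uq_act h)
  (Uq_lift_zmod (Uq_act_serre12 h) (Uq_act_serre21 h)).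
HB.instance Definition _ h := GRing.isMonoidMorphism.Build Uq Uq (Uq_act h)
  (Uq_lift_monoid (Uq_act_serre12 h) (Uq_act_serre21 h)).
HB.instance Definition _ h := GRing.isScalable.Build K Uq Uq *:%R (Uq_act h)
  (Uq_lift_scalable (Uq_act_serre12 h) (Uq_act_serre21 h)).

Lemma Uq_act_e1 h : Uq_act h Uq_e1 = h.1 *: Uq_e1.
Proof. exact: Uq_lift_e1 (Uq_act_serre12 h) (Uq_act_serre21 h). Qed.

Lemma Uq_act_e2 h : Uq_act h Uq_e2 = h.2 *: Uq_e2.
Proof. exact: Uq_lift_e2 (Uq_act_serre12 h) (Uq_act_serre21 h). Qed.

Lemma Uq_actM (h h' : K * K) u :
  Uq_act h (Uq_act h' u) = Uq_act (h.1 * h'.1, h.2 * h'.2) u.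
Proof.
rewrite [LHS](Uq_lift_unique (Uq_act h \o Uq_act h')).
rewrite [RHS](Uq_lift_unique (Uq_act _)) /=.
by rewrite !(Uq_act_e1, Uq_act_e2) !linearZ /= !(Uq_act_e1, Uq_act_e2) !scalerA
  (mulrC h'.1) (mulrC h'.2).
Qed.

Lemma Uq_act1 u : Uq_act (1, 1) u = u.
Proof.
by rewrite [RHS](Uq_lift_unique idfun) /= /Uq_act /= !scale1r.
Qed.

Definition torus : set (K * K) := [set h | h.1 != 0 /\ h.2 != 0].

Definition Hstratum (J : set Uq) : set (set Uq) :=
  [set P | Spec Uq P /\ \bigcap_(h in torus) (Uq_act h @` P) = J].

Definition Uq_e3 : Uq := Uq_e1 * Uq_e2 - q ^+ 2 *: (Uq_e2 * Uq_e1).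

Definition Uq_e3bar : Uq := Uq_e1 * Uq_e2 - q ^- 2 *: (Uq_e2 * Uq_e1).

Definition Uq_z : Uq := Uq_e2 * Uq_e3 - q ^+ 2 *: (Uq_e3 * Uq_e2).

Definition Uq_z' : Uq :=
  (1 - q ^- 2) *: (Uq_e3 * Uq_e3bar + (1 + q ^- 2) *: (Uq_z * Uq_e1)).

End QuantumB2.

(* Main.v *)
(* Write x, y, w for e1, e2, e3, put Q = q^2 and t = y w - w y.  The elements
   w, x, t, z, z' satisfy q-commutation relations, up to x t and t x, which are
   combinations of z' and w^2; moreover y is determined by w y = (t - z)/(Q - 1).
   Hence U is spanned over the central subring C[z,z'] by the products f_i m_j
   with i, j in Z, where f_i is a power of w or of y and m_j a power of x or of t.
   Commuting with w separates the exponents j (the "weights"), and commuting with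
   x or t then separates the exponents i.  This shows that an ideal I such that
   z u in I implies u in I contains all the coefficients in C[z,z'] of each of its
   elements.  So a prime ideal P not containing z is determined by its trace on
   C[z,z'], and an ideal avoiding z with prime trace is prime.  The traces of 0,
   <z'> and <z - alpha, z'> are found with representations of U in which z and z'
   act as arbitrary scalars.
   What remains is commutative algebra in two variables: a chain
   p0 < p1 < p2 < (X - alpha, Y) of primes of C[X,Y] cannot exist, and over an
   algebraically closed field the primes that contain Y are (Y) and the
   (X - alpha, Y).  Finally the torus permutes the ideals <z - alpha, z'>, alpha <> 0,
   transitively, and their intersection is <z'>. *)
From HB Require Import structures.
Require Import Defs.
From mathcomp Require Import all_boot all_order all_algebra.
From mathcomp Require Import boolp classical_sets functions reals.
From mathcomp Require Import complex.
From mathcomp Require Import ring zify.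
(* The notations of these two files clash with those of classical_sets. *)
From mathcomp Require Import -(notations) finmap monalg.
Set Implicit Arguments.
Unset Strict Implicit.
Unset Printing Implicit Defensive.
Import Order.TTheory GRing.Theory Num.Theory.
Local Open Scope ring_scope.
Local Open Scope classical_set_scope.

(** * Sums and maxima over finite sequences *)

Lemma partition_big_uniq (V : nmodType) (I T : eqType) (r : seq I) (h : I -> T)
    (s : seq T) (F : I -> V) :
  uniq s -> {in r, forall i, h i \in s} ->
  \sum_(i <- r) F i = \sum_(k <- s) \sum_(i <- r | h i == k) F i.
Proof.
move=> us rs; rewrite (exchange_big_dep xpredT) //= big_seq [RHS]big_seq.
apply: eq_bigr => i ir; rewrite -big_filter (_ : [seq _ <- _ | _] = [:: h i]) ?big_seq1 //.
by rewrite -(filter_pred1_uniq us) ?rs //; apply: eq_filter => k; rewrite /= eq_sym.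
Qed.

Lemma seq_argmax (T : eqType) (d : Order.disp_t) (O : orderType d) (F : T -> O) (r : seq T) :
  r != [::] -> exists2 k, k \in r & {in r, forall k', (F k' <= F k)%O}.
Proof.
elim: r => // a r IHr _; have [->|/IHr[k kr hk]] := eqVneq r [::].
  by exists a; rewrite ?mem_head // => k'; rewrite inE => /eqP->.
case: (leP (F k) (F a)) => h.
  exists a; rewrite ?mem_head // => k'; rewrite inE => /orP[/eqP->//|/hk].
  by move=> h'; apply: le_trans h.
exists k; rewrite ?inE ?kr ?orbT // => k'; rewrite inE => /orP[/eqP->|/hk//].
exact: ltW.
Qed.

(** * Normalisation in noncommutative algebras *)

Section NcRing.
Variables (K : fieldType) (A : algType K).

Inductive ncpoly :=
  NcVar of nat | NcAdd of ncpoly & ncpoly | NcOpp of ncpoly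
| NcMul of ncpoly & ncpoly | NcScale of K & ncpoly | NcZero | NcOne.

Fixpoint nceval (e : seq A) (p : ncpoly) : A :=
  match p with
  | NcVar i => e`_i
  | NcAdd p1 p2 => nceval e p1 + nceval e p2
  | NcOpp p1 => - nceval e p1
  | NcMul p1 p2 => nceval e p1 * nceval e p2
  | NcScale k p1 => k *: nceval e p1
  | NcZero => 0
  | NcOne => 1
  end.

Fixpoint ncscale (k : K) (m : seq nat) (l : seq (K * seq nat)) :=
  if l is (c, m') :: l' then (k * c, m ++ m') :: ncscale k m l' else [::].

Fixpoint ncmul (l1 l2 : seq (K * seq nat)) :=
  if l1 is (c, m) :: l then ncscale c m l2 ++ ncmul l l2 else [::].

Fixpoint ncnorm (p : ncpoly) : seq (K * seq nat) :=
  match p with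
  | NcVar i => [:: (1, [:: i])]
  | NcAdd p1 p2 => ncnorm p1 ++ ncnorm p2
  | NcOpp p1 => ncscale (- 1) [::] (ncnorm p1)
  | NcMul p1 p2 => ncmul (ncnorm p1) (ncnorm p2)
  | NcScale k p1 => ncscale k [::] (ncnorm p1)
  | NcZero => [::]
  | NcOne => [:: (1, [::])]
  end.

Definition ncword (e : seq A) (m : seq nat) : A := \prod_(i <- m) e`_i.
Definition ncsum (e : seq A) (l : seq (K * seq nat)) : A :=
  \sum_(p <- l) p.1 *: ncword e p.2.

Lemma ncsum_scale e k m l : ncsum e (ncscale k m l) = k *: (ncword e m * ncsum e l).
Proof.
elim: l => [|[c m'] l IHl] /=; first by rewrite /ncsum !big_nil mulr0 scaler0.
rewrite {1}/ncsum big_cons -/(ncsum _ _) IHl /ncsum big_cons mulrDr scalerDr /=.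
by rewrite /ncword big_cat -scalerAr scalerA.
Qed.

Lemma ncsum_norm e p : nceval e p = ncsum e (ncnorm p).
Proof.
elim: p => [i|p1 IH1 p2 IH2|p1 IH1|p1 IH1 p2 IH2|k p1 IH1||] /=.
- by rewrite /ncsum /ncword !big_seq1 scale1r.
- by rewrite /ncsum big_cat -!/(ncsum _ _) IH1 IH2.
- by rewrite ncsum_scale {1}/ncword big_nil mul1r scaleN1r IH1.
- rewrite {}IH1 {}IH2; elim: (ncnorm p1) => [|[c m] l IHl].
    by rewrite /ncsum !big_nil mul0r.
  rewrite /= /ncsum !(big_cons, big_cat) mulrDl -!/(ncsum _ _) IHl ncsum_scale.
  by rewrite scalerAl.
- by rewrite ncsum_scale {1}/ncword big_nil mul1r IH1.
- by rewrite /ncsum big_nil.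
- by rewrite /ncsum big_seq1 /ncword big_nil scale1r.
Qed.

(** Written by plain recursion, so that the evaluation in [ncring] reduces every comparison of words
    to a literal boolean. *)
Fixpoint ncweq (m1 m2 : seq nat) : bool :=
  match m1, m2 with
  | [::], [::] => true
  | i :: m1', j :: m2' => eqn i j && ncweq m1' m2'
  | _, _ => false
  end.

Lemma ncweqE m1 m2 : ncweq m1 m2 = (m1 == m2).
Proof. by elim: m1 m2 => [|i m1 IHm] [|j m2] //=; rewrite IHm. Qed.

Fixpoint nccoef (m : seq nat) (l : seq (K * seq nat)) : K :=
  if l is (c, m') :: l' then
    if ncweq m' m then c + nccoef m l' else nccoef m l'
  else 0.

Lemma nccoefE m l : nccoef m l = \sum_(p <- l | p.2 == m) p.1.
Proof.
by elim: l => [|[c m'] l IHl] /=; rewrite ?big_nil ?big_cons ?IHl ?ncweqE.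
Qed.

Fixpoint ncmem (m : seq nat) (ms : seq (seq nat)) : bool :=
  if ms is m' :: ms' then ncweq m m' || ncmem m ms' else false.

Lemma ncmemE m ms : ncmem m ms = (m \in ms).
Proof. by elim: ms => [//|m' ms IHms] /=; rewrite in_cons IHms ncweqE. Qed.

Fixpoint ncwords (l : seq (K * seq nat)) (ms : seq (seq nat)) :=
  if l is (_, m) :: l' then ncwords l' (if ncmem m ms then ms else m :: ms) else ms.

Lemma mem_ncwords l ms p : (p \in ms) || (p \in map snd l) -> p \in ncwords l ms.
Proof.
elim: l ms => [|[c m] l IHl] ms /=; first by rewrite orbF.
rewrite in_cons ncmemE => h; apply: IHl; case: ifP h => mms;
  by rewrite ?in_cons => /or3P[->|/eqP->|->]; rewrite ?eqxx ?mms ?orbT.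
Qed.

Lemma uniq_ncwords l ms : uniq ms -> uniq (ncwords l ms).
Proof.
elim: l ms => [//|[c m] l IHl] ms ums /=; apply: IHl.
by rewrite ncmemE; case: ifP => //= ->.
Qed.

Fixpoint ncall (P : seq nat -> Prop) (ms : seq (seq nat)) : Prop :=
  if ms is m :: ms' then P m /\ ncall P ms' else True.

(** Both sides expand to lists of coefficient-word pairs in which a word may recur. Regrouping the
    difference by word shows that it vanishes once each collected coefficient is zero in [K]. *)
Lemma ncring_correct e p1 p2 :
  let l := ncnorm (NcAdd p1 (NcOpp p2)) in
  ncall (fun m => nccoef m l = 0) (ncwords l [::]) ->
  nceval e p1 = nceval e p2.
Proof.
move=> l h; apply/eqP; rewrite -subr_eq0; apply/eqP.
rewrite -[LHS]/(nceval e (NcAdd p1 (NcOpp p2))) ncsum_norm -/l.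
have allp p : p \in l -> p.2 \in ncwords l [::].
  by move=> pl; apply: mem_ncwords; rewrite map_f.
have ums : uniq (ncwords l [::]) by apply: uniq_ncwords.
rewrite /ncsum.
rewrite (partition_big_uniq (h := snd) _ ums) //.
elim: (ncwords l [::]) h => [|m ms IHm] /=; first by rewrite big_nil.
case=> hm {}/IHm hms; rewrite big_cons hms addr0.
rewrite (eq_bigr (fun p => p.1 *: ncword e m)) => [|p /eqP-> //].
by rewrite -scaler_suml -nccoefE hm scale0r.
Qed.
End NcRing.

Ltac nc_mem x e := lazymatch e with
  | x :: _ => constr:(true)
  | _ :: ?e' => nc_mem x e'
  | _ => constr:(false)
  end.
Ltac nc_add x e := let b := nc_mem x e in lazymatch b with
  | true => e
  | false => constr:(x :: e)
  end.
Ltac nc_index x e := lazymatch e with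
  | x :: _ => constr:(0%N)
  | _ :: ?e' => let i := nc_index x e' in constr:(i.+1)
  end.
Ltac nc_vars e t := lazymatch t with
  | (?a + ?b)%R => let e1 := nc_vars e a in nc_vars e1 b
  | (- ?a)%R => nc_vars e a
  | (?a * ?b)%R => let e1 := nc_vars e a in nc_vars e1 b
  | (_ *: ?a)%R => nc_vars e a
  | (?a ^+ _)%R => nc_vars e a
  | 0%R => e
  | 1%R => e
  | _ => nc_add t e
  end.
Ltac nc_reify K e t := lazymatch t with
  | (?a + ?b)%R =>
    let p := nc_reify K e a in let r := nc_reify K e b in constr:(@NcAdd K p r)
  | (- ?a)%R => let p := nc_reify K e a in constr:(@NcOpp K p)
  | (?a * ?b)%R =>
    let p := nc_reify K e a in let r := nc_reify K e b in constr:(@NcMul K p r)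
  | (?k *: ?a)%R => let p := nc_reify K e a in constr:(@NcScale K k p)
  | (?a ^+ 2)%R => let p := nc_reify K e a in constr:(@NcMul K p p)
  | (?a ^+ 3)%R => let p := nc_reify K e a in constr:(@NcMul K p (@NcMul K p p))
  | 0%R => constr:(@NcZero K)
  | 1%R => constr:(@NcOne K)
  | _ => let i := nc_index t e in constr:(@NcVar K i)
  end.
(* Leaves one goal in [K] per monomial: the equality of its coefficients. *)
Ltac ncring K A := lazymatch goal with |- ?a = ?b =>
  let e0 := nc_vars (@nil A) a in let e := nc_vars e0 b in
  let p := nc_reify K e a in let r := nc_reify K e b in
  apply: (@ncring_correct K A e p r);
  lazy beta iota zeta delta [ncall nccoef ncwords ncnorm ncscale ncmul ncmem
    ncweq eqn andb orb cat];
  do ?[split]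
  end.

(** * Relations in U *)

Section Relations.
Variables (K : fieldType) (A : algType K) (Q : K) (x y : A).
Hypothesis Q0 : Q != 0.
Hypothesis serre_xy : x ^+ 2 * y - (Q + Q^-1) *: (x * y * x) + y * x ^+ 2 = 0.
Hypothesis serre_yx : y ^+ 3 * x - (Q + 1 + Q^-1) *: (y ^+ 2 * x * y)
  + (Q + 1 + Q^-1) *: (y * x * y ^+ 2) - x * y ^+ 3 = 0.
Let w := x * y - Q *: (y * x).
Let z := y * w - Q *: (w * y).
Let t := y * w - w * y.
Let z' := (1 - Q^-1) *: (w * (x * y - Q^-1 *: (y * x)) + (1 + Q^-1) *: (z * x)).

Lemma rel_xy : x * y = Q *: (y * x) + w.
Proof. by rewrite addrC subrK. Qed.

Lemma rel_yw : y * w = Q *: (w * y) + z.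
Proof. by rewrite addrC subrK. Qed.

(** The difference of the two sides is the left side of the first Serre relation. *)
Lemma rel_xw : x * w = Q^-1 *: (w * x).
Proof.
transitivity (Q^-1 *: (w * x)
    + (x ^+ 2 * y - (Q + Q^-1) *: (x * y * x) + y * x ^+ 2)).
  by rewrite /w; ncring K A; field.
by rewrite serre_xy addr0.
Qed.

(** The commutator of [y] and [z] is [- Q] times the left side of the second Serre relation. *)
Lemma rel_yz : y * z = z * y.
Proof.
transitivity (z * y - Q *: (y ^+ 3 * x - (Q + 1 + Q^-1) *: (y ^+ 2 * x * y)
  + (Q + 1 + Q^-1) *: (y * x * y ^+ 2) - x * y ^+ 3)).
  by rewrite /z /w; ncring K A; field.
by rewrite serre_yx scaler0 subr0.
Qed.

(** The commutator of [x] and [z] is [Q] times the commutator of [y] with the left side of the first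
    Serre relation. *)
Lemma rel_xz : x * z = z * x.
Proof.
transitivity (z * x
  + Q *: (y * (x ^+ 2 * y - (Q + Q^-1) *: (x * y * x) + y * x ^+ 2)
          - (x ^+ 2 * y - (Q + Q^-1) *: (x * y * x) + y * x ^+ 2) * y)).
  by rewrite /z /w; ncring K A; field.
by rewrite serre_xy mulr0 mul0r subrr scaler0 addr0.
Qed.

Lemma rel_wz : w * z = z * w.
Proof.
transitivity (z * w + x * (y * z - z * y) + (x * z - z * x) * y
    - Q *: (y * (x * z - z * x) + (y * z - z * y) * x)).
  by rewrite /w; ncring K A; ring.
by rewrite rel_xz rel_yz !subrr !(mulr0, mul0r, addr0) scaler0 subr0.
Qed.

Lemma rel_t : t = (Q - 1) *: (w * y) + z.
Proof. by rewrite /t /z; ncring K A; ring. Qed.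

Lemma rel_tw : t * w = Q *: (w * t).
Proof.
transitivity (Q *: (w * t) + (z * w - w * z)).
  by rewrite /t /z; ncring K A; ring.
by rewrite rel_wz subrr addr0.
Qed.

Lemma rel_yt : y * t = Q *: (t * y).
Proof.
transitivity (Q *: (t * y) + (y * z - z * y)).
  by rewrite /t /z; ncring K A; ring.
by rewrite rel_yz subrr addr0.
Qed.

Let xtE : x * t = (1 - Q^-1) *: (w * x * y) + z * x.
Proof.
transitivity ((Q - 1) *: ((x * w) * y) + x * z).
  by rewrite rel_t; ncring K A; ring.
by rewrite rel_xz rel_xw; ncring K A; field.
Qed.

(** This form of [z'] drives the rest: it makes centrality a short computation and expresses [x * t]
    through [z'] and [w * w]. *)
Lemma rel_z' : z' = (1 - Q ^- 2) *: (x * t) + ((1 - Q^-1) * Q ^- 2) *: (w * w).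
Proof. by rewrite xtE /z' /z /w; ncring K A; field. Qed.

Lemma rel_tx : t * x = x * t - (1 - Q^-1) *: (w * w).
Proof. by rewrite xtE rel_t /z /w; ncring K A; field. Qed.

Let wxE : w * x = Q *: (x * w).
Proof. by rewrite rel_xw scalerA mulfV ?scale1r. Qed.

Lemma rel_xz' : x * z' = z' * x.
Proof.
transitivity (z' * x + (1 - Q ^- 2) *: (x * (x * t - t * x))
    + ((1 - Q^-1) * Q ^- 2) *: ((x * w) * w - w * (w * x))).
  by rewrite rel_z'; ncring K A; ring.
transitivity (z' * x + (1 - Q ^- 2) * (1 - Q^-1) *: (x * w * w)
    + ((1 - Q^-1) * Q ^- 2) *: ((x * w) * w - Q *: (w * (x * w)))).
  by rewrite rel_tx wxE; ncring K A; ring.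
by rewrite (mulrA w) wxE; ncring K A; field.
Qed.

(** Moving [y] through [x * t] and through [w * w] leaves a multiple of [w * t] each time, and the
    two multiples cancel. *)
Lemma rel_yz' : y * z' = z' * y.
Proof.
transitivity (z' * y + (1 - Q ^- 2) *: (y * x * t - x * (t * y))
    + ((1 - Q^-1) * Q ^- 2) *: (y * w * w - w * w * y)).
  by rewrite rel_z'; ncring K A; ring.
have -> : y * x * t = x * (t * y) - Q^-1 *: (w * t).
  transitivity (Q^-1 *: (x * (y * t) - w * t)).
    by rewrite /w; ncring K A; field.
  by rewrite rel_yt; ncring K A; field.
have -> : y * w * w - w * w * y = (Q + 1) *: (w * t).
  transitivity (Q *: (w * y * w) + z * w - w * w * y).
    by rewrite rel_yw; ncring K A; ring.
  by rewrite -rel_wz rel_t -(mulrA w y) rel_yw; ncring K A; ring.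
by ncring K A; field.
Qed.

End Relations.

(** * Two-sided ideals *)

Section Ideals.
Variables (K : fieldType) (A : algType K).
Implicit Types (I : set A) (g : A).

Lemma tsidealM I a b u : two_sided_ideal I -> I u -> I (a * u * b).
Proof. by case=> _ _; apply. Qed.

Lemma tsidealMl I a u : two_sided_ideal I -> I u -> I (a * u).
Proof. by move=> hI hu; rewrite -[a * u]mulr1; apply: tsidealM. Qed.

Lemma tsidealMr I b u : two_sided_ideal I -> I u -> I (u * b).
Proof. by move=> hI hu; rewrite -[u]mul1r; apply: tsidealM. Qed.

Lemma tsidealZ I (c : K) u : two_sided_ideal I -> I u -> I (c *: u).
Proof. by move=> hI hu; rewrite -mulr_algl; apply: tsidealMl. Qed.

Lemma tsidealZ_inv I (c : K) u : two_sided_ideal I -> c != 0 -> I (c *: u) -> I u.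
Proof. by move=> hI c0 /(tsidealZ c^-1 hI); rewrite scalerA mulVf ?scale1r. Qed.

Lemma tsidealD I u v : two_sided_ideal I -> I u -> I v -> I (u + v).
Proof. by case=> _ + _; apply. Qed.

Lemma tsidealB I u v : two_sided_ideal I -> I u -> I v -> I (u - v).
Proof. by move=> hI hu hv; apply: (tsidealD hI hu) (two_sided_idealN hI hv). Qed.

Lemma tsideal_sum I (T : eqType) (r : seq T) (F : T -> A) :
  two_sided_ideal I -> {in r, forall i, I (F i)} -> I (\sum_(i <- r) F i).
Proof.
move=> hI hF; rewrite big_seq; apply: (big_ind I) => [|u v|i ir].
- by case: hI.
- exact: tsidealD.
- exact: hF.
Qed.

(* The operator [v |-> g * v - b *: (v * g)] removes the terms of eigenvalue [b]. *)
Lemma tsideal_sep I g (a : K) u (r : seq (K * A)) : two_sided_ideal I ->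
  g * u = a *: (u * g) ->
  {in r, forall p, g * p.2 = p.1 *: (p.2 * g) /\ p.1 != a} ->
  I (u + \sum_(p <- r) p.2) -> exists k, I (u * g ^+ k).
Proof.
move=> hI; elim: {r}(size r) {-2}r (erefl (size r)) u => [|n IHn] [|[b v] r] //= sr u hu hr.
  by rewrite big_nil addr0 => Iu; exists 0%N; rewrite expr0 mulr1.
rewrite big_cons /= => Iu; have [hv ba] := hr _ (mem_head _ _); rewrite /= in hv ba.
(* The operator with parameter [b] kills [v] and rescales the other terms, up to a right factor [g]
   that keeps their eigenvalues. The induction is on the size because the terms themselves
   change. *)
pose r' := [seq (p.1, (p.1 - b) *: (p.2 * g)) | p <- r].
have [||||k Ik] := IHn r' _ ((a - b) *: (u * g)).
- by rewrite size_map; case: sr.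
- by rewrite -scalerAr mulrA hu -!scalerAl !scalerA mulrC.
- move=> _ /mapP[p pr ->]; have [|hp pa] := hr p; first by rewrite in_cons pr orbT.
  by split=> //=; rewrite -scalerAr mulrA hp -!scalerAl !scalerA mulrC.
- have := tsidealB hI (tsidealMl g hI Iu) (tsidealZ b hI (tsidealMr g hI Iu)).
  congr I; rewrite !mulrDr !mulrDl hu hv mulr_sumr mulr_suml !scalerDr scaler_sumr.
  rewrite opprD addrACA -scalerBl opprD [X in _ + X]addrACA subrr add0r -sumrB.
  congr (_ + _); rewrite big_map big_seq [RHS]big_seq; apply: eq_bigr => p pr /=.
  have [|hp _] := hr p; first by rewrite in_cons pr orbT.
  by rewrite hp scalerBl.
exists k.+1; rewrite exprS mulrA; apply: (@tsidealZ_inv I (a - b)) => //.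
  by rewrite subr_eq0 eq_sym.
by rewrite scalerAl.
Qed.

Definition central (c : A) : Prop := forall u, c * u = u * c.

Lemma central_alg (k : K) : central k%:A.
Proof. by move=> u; rewrite mulr_algl mulr_algr. Qed.

Lemma centralM c d : central c -> central d -> central (c * d).
Proof. by move=> hc hd u; rewrite -mulrA hd mulrA hc mulrA. Qed.

Lemma centralX (c : A) n : central c -> central (c ^+ n).
Proof.
move=> hc; elim: n => [|n IHn]; last by rewrite exprS; apply: centralM.
by move=> u; rewrite mul1r mulr1.
Qed.

Lemma tsideal_quot_central I c : two_sided_ideal I -> central c ->
  two_sided_ideal [set u | I (c * u)].
Proof.
move=> hI hc; split=> /= [|u v hu hv|a u b hu].
- by rewrite mulr0; case: hI.
- by rewrite mulrDr; apply: tsidealD.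
- by rewrite !mulrA hc -!mulrA (mulrA c) mulrA; apply: tsidealM.
Qed.

(** Primeness is applied to the ideal of multiples of [c] and the ideal of all [v] with [c * v] in
    [I]; since [c] is central, their products lie in [I]. *)
Lemma prime_central I c u : prime_ideal I -> central c -> I (c * u) -> I c \/ I u.
Proof.
move=> [hI _ pI] hc Icu.
have hJ : two_sided_ideal [set c * v | v in [set: A]].
  split=> [|_ _ [v _ <-] [v' _ <-]|a _ b [v _ <-]].
  - by exists 0; rewrite ?mulr0.
  - by exists (v + v'); rewrite ?mulrDr.
  - by exists (a * v * b) => //; rewrite !mulrA hc.
have [|h|h] := pI _ _ hJ (tsideal_quot_central hI hc).
- move=> _ [_ [v _ <-] [v' /= Iv' <-]].
  by rewrite (hc v) -mulrA; apply: tsidealMl.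
- by left; apply: h; exists 1; rewrite ?mulr1.
- by right; apply: h.
Qed.

Lemma exp_comm (k : K) (u v : A) n :
  u * v = k *: (v * u) -> u ^+ n * v = k ^+ n *: (v * u ^+ n).
Proof.
move=> uv; elim: n => [|n IHn]; first by rewrite !expr0 mul1r mulr1 scale1r.
rewrite exprSr -mulrA uv -scalerAr (mulrA _ v) IHn.
by rewrite -scalerAl scalerA exprS mulrA.
Qed.

Lemma comm_exp (k : K) (u v : A) n :
  u * v = k *: (v * u) -> u * v ^+ n = k ^+ n *: (v ^+ n * u).
Proof.
move=> uv; elim: n => [|n IHn]; first by rewrite !expr0 mul1r mulr1 scale1r.
rewrite exprSr mulrA IHn -scalerAl -(mulrA _ u v) uv -scalerAr scalerA.
by rewrite -[in LHS]exprSr !mulrA.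
Qed.

End Ideals.

Lemma prime_ideal_proper (A : nzRingType) (P : set A) : prime_ideal P -> ~ P 1.
Proof.
move=> [[_ _ PM] PT _] P1; apply: PT; apply/seteqP; split=> // u _.
by rewrite -[u]mulr1 -[_ * 1]mulr1; apply: PM.
Qed.

Lemma saturation_ideal (K : fieldType) (A : algType K) (c : A) (I : set A) :
  central c -> two_sided_ideal I -> two_sided_ideal [set u | exists n, I (c ^+ n * u)].
Proof.
move=> hc hI; split=> /= [|u v [n hu] [m hv]|a u b [n hu]].
- by exists 0%N; rewrite mulr0; case: hI.
- exists (n + m)%N; rewrite mulrDr; apply: (tsidealD hI).
    by rewrite addnC exprD -mulrA; exact: tsidealMl.
  by rewrite exprD -mulrA; exact: tsidealMl.
- exists n; rewrite !mulrA (centralX n hc a) -(mulrA a); exact: tsidealM.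
Qed.

Definition saturated (A : nzRingType) (c : A) (I : set A) : Prop :=
  forall u, I (c * u) -> I u.

(** The interface through which [Uq] is used below, with [Q] for [q ^+ 2]. The field [b2_ind] says
    that [x] and [y] generate the algebra. *)
Record b2_system (K : fieldType) (A : algType K) (Q : K) (x y w z z' t : A) : Prop :=
  B2System {
    b2_xw : x * w = Q^-1 *: (w * x);
    b2_xy : x * y = Q *: (y * x) + w;
    b2_yw : y * w = Q *: (w * y) + z;
    b2_xz : x * z = z * x;
    b2_yz : y * z = z * y;
    b2_t : t = (Q - 1) *: (w * y) + z;
    b2_tw : t * w = Q *: (w * t);
    b2_yt : y * t = Q *: (t * y);
    b2_z' : z' = (1 - Q ^- 2) *: (x * t) + ((1 - Q^-1) * Q ^- 2) *: (w * w);
    b2_tx : t * x = x * t - (1 - Q^-1) *: (w * w);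
    b2_xz' : x * z' = z' * x;
    b2_yz' : y * z' = z' * y;
    b2_ind : forall P : A -> Prop, P 1 -> (forall u v, P u -> P v -> P (u + v)) ->
      (forall k u, P u -> P (k *: u)) -> (forall u, P u -> P (x * u)) ->
      (forall u, P u -> P (y * u)) -> forall u, P u
  }.

Definition Uq_theta (K : fieldType) (q : K) : Uq q :=
  Uq_e2 q * Uq_e3 q - Uq_e3 q * Uq_e2 q.

Section UqSystem.
Variables (K : fieldType) (q : K).
Hypothesis q0 : q != 0.
Local Notation x := (Uq_e1 q).
Local Notation y := (Uq_e2 q).

Lemma Uq_gen_ind (P : Uq q -> Prop) :
  P 1 -> (forall u v, P u -> P v -> P (u + v)) -> (forall k u, P u -> P (k *: u)) ->
  (forall u, P u -> P (x * u)) -> (forall u, P u -> P (y * u)) -> forall u, P u.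
Proof.
move=> P1 PD PZ Px Py; elim/Uq_ind => p.
rewrite (monalgE p) raddf_sum; apply: (big_ind P) => // [|m _].
  by rewrite -(scale0r 1); apply: PZ.
have -> : (mkmalgU m (mcoeff m p) : free_alg2 K) = mcoeff m p *: mkmalgU m 1.
  by apply/malgP => m'; rewrite mcoeffZ !mcoeffU mulr_natr.
rewrite -[X in P X]/(Uq_pi q (mcoeff m p *: (mkmalgU m 1 : free_alg2 K))).
rewrite pi_scalable free_monomE rmorph_prod; apply: PZ.
elim: (fmonom_val m) => [|i s IHs]; first by rewrite big_nil.
rewrite big_cons; have [->|i1] := eqVneq i ord0; first exact: Px.
have -> : i = ord_max by apply/val_inj; case: i i1 => [[|[|]]].
exact: Py.
Qed.

Lemma Uq_b2_system :
  b2_system (q ^+ 2) x y (Uq_e3 q) (Uq_z q) (Uq_z' q) (Uq_theta q).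
Proof.
have Q0 : q ^+ 2 != 0 by exact: expf_neq0.
have s12 := Uq_serre12 q; have s21 := Uq_serre21 q.
split.
- exact: rel_xw Q0 s12.
- exact: rel_xy.
- exact: rel_yw.
- exact: rel_xz Q0 s12.
- exact: rel_yz Q0 s21.
- exact: rel_t.
- exact: rel_tw Q0 s12 s21.
- exact: rel_yt Q0 s21.
- exact: rel_z' Q0 s12.
- exact: rel_tx Q0 s12.
- exact: rel_xz' Q0 s12.
- exact: rel_yz' Q0 s12 s21.
- exact: Uq_gen_ind.
Qed.
End UqSystem.

(** * Separation of coefficients over the centre *)

Section B2System.
Variables (K : fieldType) (A : algType K) (Q : K) (x y w z z' t : A).
Hypothesis H : b2_system Q x y w z z' t.
Hypothesis Q0 : Q != 0.
Hypothesis Qn : forall n : nat, Q ^+ n.+1 != 1.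

Lemma expz_inj : injective (fun i : int => Q ^ i).
Proof.
have H2 (i : int) : Q ^ i = 1 -> i = 0.
  case: i => [[//|n]|n]; first by move/eqP; rewrite (negPf (Qn n)).
  move/(congr1 GRing.inv); rewrite NegzE -invr_expz invrK invr1 => /eqP.
  by rewrite (negPf (Qn n)).
move=> i j e; apply/eqP; rewrite -subr_eq0; apply/eqP/H2.
by rewrite expfzDr // -invr_expz e mulfV // expfz_neq0.
Qed.

Let Q1 : Q - 1 != 0.
Proof. by rewrite subr_eq0; have := Qn 0; rewrite expr1. Qed.

Lemma b2_centralP c : c * x = x * c -> c * y = y * c -> central c.
Proof.
move=> cx cy; apply: (b2_ind H) => [|u v hu hv|k u hu|u hu|u hu].
- by rewrite mulr1 mul1r.
- by rewrite mulrDr mulrDl hu hv.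
- by rewrite -scalerAr -scalerAl hu.
- by rewrite mulrA cx -mulrA hu mulrA.
- by rewrite mulrA cy -mulrA hu mulrA.
Qed.

Lemma z_central : central z.
Proof. by apply: b2_centralP; rewrite ?(b2_xz H) ?(b2_yz H). Qed.

Lemma z'_central : central z'.
Proof. by apply: b2_centralP; rewrite ?(b2_xz' H) ?(b2_yz' H). Qed.

(** * Weights, and parts of top weight *)

Definition weight (j : int) (r : A) : Prop := w * r = Q ^ j *: (r * w).

Lemma weight_central c : central c -> weight 0 c.
Proof. by move=> hc; rewrite /weight expr0z scale1r hc. Qed.

Lemma weight_w : weight 0 w. Proof. by rewrite /weight expr0z scale1r. Qed.

Lemma weight_x : weight 1 x.
Proof. by rewrite /weight expr1z (b2_xw H) scalerA mulfV ?scale1r. Qed.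

Lemma weight_t : weight (- 1) t.
Proof. by rewrite /weight (b2_tw H) exprN1 scalerA mulVf ?scale1r. Qed.

Lemma weightM i j r s : weight i r -> weight j s -> weight (i + j) (r * s).
Proof.
move=> hr hs; rewrite /weight mulrA hr -scalerAl -(mulrA r w) hs -scalerAr scalerA mulrA.
by rewrite expfzDr.
Qed.

Lemma weight0M j r s : weight 0 r -> weight j s -> weight j (r * s).
Proof. by move=> hr hs; rewrite -[j]add0r; apply: weightM. Qed.

Lemma weightX j r n : weight j r -> weight (j * n%:Z) (r ^+ n).
Proof.
move=> hr; elim: n => [|n IHn].
  by rewrite mulr0 expr0; apply: weight_central => u; rewrite mul1r mulr1.
by rewrite exprS intS mulrDr mulr1; apply: weightM.
Qed.

Lemma weight0 j : weight j 0. Proof. by rewrite /weight mulr0 mul0r scaler0. Qed.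

Lemma weightD j r s : weight j r -> weight j s -> weight j (r + s).
Proof. by move=> hr hs; rewrite /weight mulrDr mulrDl hr hs scalerDr. Qed.

Lemma weightZ j k r : weight j r -> weight j (k *: r).
Proof. by move=> hr; rewrite /weight -scalerAr hr -scalerAl !scalerA mulrC. Qed.

Lemma b2_ty : t * y = Q^-1 *: (y * t).
Proof. by rewrite (b2_yt H) scalerA mulVf ?scale1r. Qed.

(** [r] stands for the part of [v] of weight [j] and the list for the rest, of lower weight.
    Homogeneity of [r] is supplied separately where it is used. *)
Definition has_top (j : int) (r v : A) : Prop :=
  exists2 l : seq (int * A),
    {in l, forall p, weight p.1 p.2 /\ (p.1 < j)%R} & v = r + \sum_(p <- l) p.2.

Lemma has_top_refl j r : has_top j r r.
Proof. by exists [::] => //; rewrite big_nil addr0. Qed.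

Lemma has_topD j r v r' v' :
  has_top j r v -> has_top j r' v' -> has_top j (r + r') (v + v').
Proof.
move=> [l hl ->] [l' hl' ->]; exists (l ++ l').
  by move=> p; rewrite mem_cat => /orP[/hl|/hl'].
by rewrite big_cat addrACA.
Qed.

Lemma has_top_sum j (T : eqType) (s : seq T) (r v : T -> A) :
  {in s, forall i, has_top j (r i) (v i)} ->
  has_top j (\sum_(i <- s) r i) (\sum_(i <- s) v i).
Proof.
move=> h; elim: s h => [|a s IHs] h; first by rewrite !big_nil; apply: has_top_refl.
rewrite !big_cons; apply: has_topD; first by apply: h; rewrite mem_head.
by apply: IHs => i si; apply: h; rewrite in_cons si orbT.
Qed.

Lemma has_topM i j r v s : weight j s -> has_top i r v -> has_top (i + j) (r * s) (v * s).
Proof.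
move=> hs [l hl ->]; exists [seq (p.1 + j, p.2 * s) | p <- l].
  by move=> _ /mapP[p /hl[hp pi] ->] /=; split; [exact: weightM|rewrite ltrD2r].
by rewrite mulrDl mulr_suml big_map.
Qed.

Lemma has_topMl i j r v s : weight i s -> has_top j r v -> has_top (i + j) (s * r) (s * v).
Proof.
move=> hs [l hl ->]; exists [seq (i + p.1, s * p.2) | p <- l].
  by move=> _ /mapP[p /hl[hp pi] ->] /=; split; [exact: weightM|rewrite ltrD2l].
by rewrite mulrDr mulr_sumr big_map.
Qed.

Lemma has_topZ j k r v : has_top j r v -> has_top j (k *: r) (k *: v).
Proof.
move=> [l hl ->]; exists [seq (p.1, k *: p.2) | p <- l].
  by move=> _ /mapP[p /hl[hp pi] ->] /=; split; first exact: weightZ.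
by rewrite scalerDr scaler_sumr big_map.
Qed.

Lemma has_top_low i j r v : weight i r -> has_top i r v -> (i < j)%R -> has_top j 0 v.
Proof.
move=> hr [l hl ->] ij; exists ((i, r) :: l); last by rewrite big_cons add0r.
move=> p; rewrite in_cons => /orP[/eqP-> //|/hl[hp pi]].
by split=> //; apply: lt_trans ij.
Qed.

(** One product [w * y] equals [(t - z) / (Q - 1)], with [z] of weight 0 and [t] of weight -1. So,
    to top order, each of the [d] pairs contributes [- z / (Q - 1)]. *)
Lemma has_top_wy d : has_top 0 ((- (Q - 1)^-1) ^+ d *: z ^+ d) (w ^+ d * y ^+ d).
Proof.
elim: d => [|d IHd]; first by rewrite !expr0 mulr1 scale1r; apply: has_top_refl.
have -> : w ^+ d.+1 * y ^+ d.+1 = - (Q - 1)^-1 *: (w ^+ d * y ^+ d * z)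
    + ((Q - 1)^-1 * Q^-1 ^+ d) *: (w ^+ d * y ^+ d * t).
  rewrite exprSr exprS mulrA -(mulrA _ w).
  have -> : w * y = (Q - 1)^-1 *: (t - z) by rewrite (b2_t H) addrK scalerA mulVf ?scale1r.
  rewrite -scalerAr -scalerAl mulrBr mulrBl scalerBr addrC scaleNr.
  rewrite -[_ * z * y ^+ d]mulrA z_central mulrA; congr (_ + _).
  by rewrite -scalerA -(mulrA _ t) (comm_exp d b2_ty) -scalerAr mulrA.
rewrite -[(- _) ^+ d.+1 *: _]addr0; apply: has_topD; last first.
  rewrite -(scaler0 A ((Q - 1)^-1 * Q^-1 ^+ d)); apply: has_topZ.
  apply: has_top_low (has_topM weight_t IHd) _ => //.
  rewrite -scalerAl; apply: weightZ; apply: weightM weight_t.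
  by apply: weight_central; apply: centralX z_central.
rewrite exprS -scalerA; apply: has_topZ.
rewrite (exprSr z) scalerAl -[0 : int]addr0; apply: has_topM IHd.
exact: weight_central z_central.
Qed.

(* The products [b2_f i * b2_m j] span over the subring generated by [z], [z']. *)
Definition b2_f (i : int) : A :=
  match i with Posz n => w ^+ n | Negz n => y ^+ n.+1 end.
Definition b2_g (j : int) : A := if j is Posz _ then x else t.
Definition b2_m (j : int) : A := b2_g j ^+ absz j.

Lemma weight_m j : weight j (b2_m j).
Proof.
case: j => n; rewrite /b2_m.
  by rewrite -[X in weight X _](mul1r n%:Z); exact: (weightX n weight_x).
by rewrite [X in weight X _]NegzE -mulN1r; exact: (weightX n.+1 weight_t).
Qed.

(** To top order and up to a scalar, [y] behaves as [z] divided by [w], by [has_top_wy]. Multiplying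
    by a large power of [w] thus turns [b2_f i] into an honest power of [w], for either sign of
    [i]. *)
Lemma has_top_f N (i j : int) : (absz i <= N)%N ->
  exists k d e, [/\ k != 0, e%:Z = N%:Z + i
    & has_top j (k *: (z ^+ d * (w ^+ e * b2_m j))) (w ^+ N * (b2_f i * b2_m j))].
Proof.
case: i => n /= nN.
  exists 1, 0%N, (N + n)%N; split=> //; rewrite ?oner_eq0 //.
  by rewrite scale1r mul1r mulrA -exprD; apply: has_top_refl.
exists ((- (Q - 1)^-1) ^+ n.+1), n.+1, (N - n.+1)%N; split.
- by rewrite expf_neq0 // oppr_eq0 invr_eq0.
- by rewrite NegzE -subzn.
have -> : w ^+ N * (y ^+ n.+1 * b2_m j) = w ^+ (N - n.+1) * (w ^+ n.+1 * y ^+ n.+1 * b2_m j).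
  by rewrite !mulrA -exprD subnK.
have h := has_topM (weight_m j) (has_top_wy n.+1); rewrite add0r in h.
have {h} := has_topMl (weightX (N - n.+1) weight_w) h; rewrite mul0r add0r.
congr has_top; rewrite -scalerAl -scalerAr; congr (_ *: _).
by rewrite !mulrA (centralX _ z_central).
Qed.

(** * Descent on exponents inside an ideal saturated at [z] *)

Lemma geom_neq0 (p : K) n : p ^+ n.+1 != 1 -> \sum_(i < n.+1) p ^+ i != 0.
Proof.
by rewrite -subr_eq0 subrX1 mulf_eq0 negb_or => /andP[].
Qed.

Let QX (k : nat) n : (0 < k)%N -> (Q ^+ k) ^+ n.+1 != 1.
Proof. by rewrite -exprM; case: k => // k _; rewrite mulSn addSn. Qed.

Lemma yw_exp n : y * w ^+ n.+1 =
  Q ^+ n.+1 *: (w ^+ n.+1 * y) + (\sum_(i < n.+1) Q ^+ i) *: (z * w ^+ n).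
Proof.
elim: n => [|n IHn].
  by rewrite big_ord1 !expr1 !expr0 scale1r mulr1 (b2_yw H).
rewrite [in LHS]exprSr mulrA IHn mulrDl -!scalerAl -(mulrA _ y) (b2_yw H) mulrDr scalerDr.
rewrite -scalerAr scalerA -exprSr mulrA -exprSr -addrA; congr (_ + _).
rewrite -(mulrA z) -exprSr -z_central -scalerDl; congr (_ *: _).
by rewrite [RHS]big_ord_recr /= addrC.
Qed.

(** Exchanging [t] with one factor [x] releases a multiple of [w * w], which is then moved left past
    the other factors. The scalars add up to a geometric sum in [Q ^- 2], nonzero since [Q] is not a
    root of unity. *)
Lemma tx_exp n :
  exists2 k, k != 0 & t * x ^+ n.+1 - x ^+ n.+1 * t = k *: (w ^+ 2 * x ^+ n).
Proof.
exists (- (1 - Q^-1) * \sum_(i < n.+1) (Q ^- 2) ^+ i).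
  rewrite mulf_neq0 ?oppr_eq0 ?subr_eq0 //.
    by rewrite eq_sym invr_eq1 -subr_eq0.
  by apply: geom_neq0; rewrite exprVn invr_eq1 QX.
elim: n => [|n IHn].
  by rewrite big_ord1 !expr0 !mulr1 !expr1 (b2_tx H) addrC addKr scaleNr.
have -> : t * x ^+ n.+2 - x ^+ n.+2 * t =
    (t * x ^+ n.+1 - x ^+ n.+1 * t) * x + x ^+ n.+1 * (t * x - x * t).
  by rewrite (exprSr x n.+1); move: (x ^+ n.+1) => u; ncring K A; ring.
rewrite IHn (b2_tx H) [x * t - _]addrC addrK mulrN -scalerAr -scalerAl -mulrA -exprSr -expr2.
rewrite (exp_comm _ (comm_exp 2 (b2_xw H))) -scaleNr !scalerA -scalerDl; congr (_ *: _).
by rewrite [in RHS]big_ord_recr /= mulrDr (exprVn Q 2).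
Qed.

Lemma xt_exp n :
  exists2 k, k != 0 & x * t ^+ n.+1 - t ^+ n.+1 * x = k *: (w ^+ 2 * t ^+ n).
Proof.
exists ((1 - Q^-1) * \sum_(i < n.+1) (Q ^+ 2) ^+ i).
  rewrite mulf_neq0 ?oppr_eq0 ?subr_eq0 //.
    by rewrite eq_sym invr_eq1 -subr_eq0.
  by apply: geom_neq0; rewrite QX.
elim: n => [|n IHn].
  by rewrite big_ord1 !expr0 !mulr1 !expr1 (b2_tx H) subKr.
have -> : x * t ^+ n.+2 - t ^+ n.+2 * x =
    (x * t ^+ n.+1 - t ^+ n.+1 * x) * t + t ^+ n.+1 * (x * t - t * x).
  by rewrite (exprSr t n.+1); move: (t ^+ n.+1) => u; ncring K A; ring.
rewrite IHn (b2_tx H) subKr -scalerAr -scalerAl -mulrA -exprSr -expr2.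
rewrite (exp_comm _ (comm_exp 2 (b2_tw H))) !scalerA -scalerDl; congr (_ *: _).
by rewrite [in RHS]big_ord_recr /= mulrDr.
Qed.

Section SaturatedIdeal.
Variable J : set A.
Hypotheses (hJ : two_sided_ideal J) (zJ : saturated z J).

(** The combination [y * w ^+ n.+1 - Q ^+ n.+1 *: (w ^+ n.+1 * y)] lies in [J] and is a nonzero
    multiple of [z * w ^+ n]; saturation cancels [z]. *)
Lemma ideal_w_exp n : J (w ^+ n) -> J 1.
Proof.
elim: n => [//|n IHn] Jw; apply/IHn/zJ.
have := tsidealB hJ (tsidealMl y hJ Jw) (tsidealZ (Q ^+ n.+1) hJ (tsidealMr y hJ Jw)).
rewrite yw_exp addrAC subrr add0r; apply: tsidealZ_inv => //.
by rewrite geom_neq0 // Qn.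
Qed.

(** Commuting with the partner of [b2_g j] ([t] for [x], [x] for [t]) lowers the exponent [b] at the
    cost of two more factors [w], so the induction on [b] needs [a] arbitrary. *)
Lemma ideal_wg a b j : J (w ^+ a * b2_g j ^+ b) -> J 1.
Proof.
elim: b a => [|b IHb] a; first by rewrite mulr1; exact: ideal_w_exp.
move=> Jw; apply: (IHb a.+2).
pose g' := if j is Posz _ then t else x.
have [l l0 hl] : exists2 l, l != 0 & w * g' = l *: (g' * w).
  rewrite /g'; case: (j) => ?.
    by exists Q^-1; rewrite ?invr_eq0 // (b2_tw H) scalerA mulVf ?scale1r.
  by exists Q => //; rewrite (b2_xw H) scalerA mulfV ?scale1r.
have [k k0 hk] : exists2 k, k != 0 &
    g' * b2_g j ^+ b.+1 - b2_g j ^+ b.+1 * g' = k *: (w ^+ 2 * b2_g j ^+ b).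
  by rewrite /g'; case: (j) => ?; [exact: tx_exp|exact: xt_exp].
apply: (tsidealZ_inv hJ k0); rewrite -addn2 exprD -mulrA scalerAr -hk mulrBr !mulrA.
apply: (tsidealB hJ); last exact: tsidealMr.
rewrite (exp_comm _ hl) -scalerAl -mulrA; apply: tsidealZ => //; exact: tsidealMl.
Qed.

End SaturatedIdeal.

Lemma b2_g_comm j e : b2_g j * w ^+ e =
  (if j is Posz _ then Q^-1 else Q) ^+ e *: (w ^+ e * b2_g j).
Proof. by case: j => ?; apply: comm_exp; [exact: b2_xw H|exact: b2_tw H]. Qed.

(** It suffices to find one coefficient in [I]: its term is subtracted and induction on the number
    of terms finishes. A term of maximal weight is isolated by separating first the weights, then
    the exponents of [w]. *)
Lemma b2_coef_in I (r : seq (int * int)) (c : int * int -> A) :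
  two_sided_ideal I -> saturated z I -> uniq r -> (forall k, central (c k)) ->
  I (\sum_(k <- r) c k * (b2_f k.1 * b2_m k.2)) -> {in r, forall k, I (c k)}.
Proof.
move=> hI zI + hc; elim: {r}(size r) {-2}r (erefl (size r)) => [|n IHn] r.
  by case: r.
move=> sr ur Ir.
have [k0 k0r Ik0] : exists2 k, k \in r & I (c k); last first.
  move=> k kr; have [->//|kk0] := eqVneq k k0.
  apply: (IHn (rem k0 r)); rewrite ?rem_uniq ?size_rem ?sr //.
    move: Ir; rewrite (big_rem k0) //= addrC => Ir.
    by have := tsidealB hI Ir (tsidealMr (b2_f k0.1 * b2_m k0.2) hI Ik0); rewrite addrK.
  by rewrite mem_rem_uniq // !inE kk0.
have [k0 k0r k0max] : exists2 k, k \in r & {in r, forall k', k'.2 <= k.2}.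
  by apply: seq_argmax; rewrite -size_eq0 sr.
(* Multiplying by [w ^+ N] turns the top weight part into a combination of
   the [w ^+ e * b2_m j], whose exponents [e] are distinguished by [b2_g j]. *)
exists k0 => //; set j := k0.2 in k0max.
pose N := \max_(k <- r) absz k.1.
(* [h k] packs the scalar, the exponent of [z] and the exponent of [w] given by [has_top_f]; its
   value outside [r] is arbitrary. *)
have /choice[h hh] (k : int * int) : exists p : K * nat * nat, k \in r ->
    [/\ p.1.1 != 0, p.2%:Z = N%:Z + k.1
      & has_top k.2 (p.1.1 *: (z ^+ p.1.2 * (w ^+ p.2 * b2_m k.2)))
                (w ^+ N * (b2_f k.1 * b2_m k.2))].
  have [kr|kr] := boolP (k \in r); last by exists (1, 0%N, 0%N).
  have [|a [d [e he]]] := @has_top_f N k.1 k.2; last by exists (a, d, e).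
  by rewrite /N; apply: (@leq_bigmax_seq _ _ xpredT (fun k : int * int => absz k.1)).
(* The parameter [n] counts the extra factors [w] that the separation of weights will produce. *)
pose F n k := c k * ((h k).1.1 *: (z ^+ (h k).1.2 * (w ^+ (n + (h k).2) * b2_m j))).
have weightF m k : weight j (F m k).
  apply: weight0M; first exact: weight_central.
  apply: weightZ; apply: weight0M; first by apply/weight_central/centralX/z_central.
  by apply: weight0M (weight_m j); rewrite -[0](mul0r (m + (h k).2)%:Z); exact: weightX weight_w.
have [l hl El] : has_top j (\sum_(k <- r | k.2 == j) F 0%N k)
    (w ^+ N * \sum_(k <- r) c k * (b2_f k.1 * b2_m k.2)).
  rewrite mulr_sumr big_mkcond /=; apply: has_top_sum => k kr.
  have [ha _ htop] := hh k kr.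
  have -> : w ^+ N * (c k * (b2_f k.1 * b2_m k.2)) =
      c k * (w ^+ N * (b2_f k.1 * b2_m k.2)) by rewrite !mulrA hc.
  have := has_topMl (weight_central (hc k)) htop; rewrite add0r.
  have := k0max k kr; rewrite le_eqVlt; case: eqVneq => [e _|_ /= kj].
    by rewrite /F add0n e.
  move=> {}htop; apply: has_top_low htop kj; apply: weight0M; first exact: weight_central.
  apply: weightZ; apply: weight0M; first by apply/weight_central/centralX/z_central.
  by apply: weight0M (weight_m _); rewrite -[0](mul0r (h k).2%:Z); exact: weightX weight_w.
have [|||n' In'] := @tsideal_sep _ _ I w (Q ^ j) (\sum_(k <- r | k.2 == j) F 0%N k)
  [seq (Q ^ p.1, p.2) | p <- l] hI.
- by apply: (big_ind (weight j)) => [||k _]; [exact: weight0|exact: weightD|exact: weightF].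
- move=> _ /mapP[p /hl[pr pj] ->] /=; split=> //.
  by apply/eqP => /expz_inj e; rewrite e ltxx in pj.
- by rewrite big_map -El; apply: tsidealMl.
have {}In' : I (\sum_(k <- r | k.2 == j) F n' k).
  have <- : w ^+ n' * (\sum_(k <- r | k.2 == j) F 0%N k) = \sum_(k <- r | k.2 == j) F n' k.
    rewrite mulr_sumr; apply: eq_bigr => k _; rewrite /F add0n exprD.
    rewrite mulrA -hc -!mulrA -!scalerAr; congr (_ *: (_ * _)).
    by rewrite !mulrA (centralX _ z_central).
  rewrite (@exp_comm _ _ (Q ^ j)); first exact: tsidealZ.
  by apply: (big_ind (weight j)) => [||k _]; [exact: weight0|exact: weightD|exact: weightF].
(* Within weight [j], only the power of [w] fails to commute with [b2_g j], because [b2_m j] is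
   itself a power of [b2_g j]. *)
have gF k : b2_g j * F n' k =
    (if j is Posz _ then Q^-1 else Q) ^+ (n' + (h k).2) *: (F n' k * b2_g j).
  set a := (if _ is Posz _ then _ else _) ^+ _; rewrite /F.
  set v := w ^+ _ * _; have gv : b2_g j * v = a *: (v * b2_g j).
    by rewrite /v mulrA b2_g_comm -scalerAl -!mulrA /b2_m -exprSr exprS.
  rewrite mulrA -hc -mulrA -scalerAr mulrA -(centralX _ z_central) -(mulrA _ _ v) gv.
  by rewrite -!scalerAr -!scalerAl !scalerA (mulrC a) !mulrA.
have [||m Im] := @tsideal_sep _ _ I (b2_g j) _ (F n' k0)
  [seq ((if j is Posz _ then Q^-1 else Q) ^+ (n' + (h k).2), F n' k)
    | k <- rem k0 r & k.2 == j] hI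
  (gF k0).
- move=> _ /mapP[k + ->] /=; rewrite mem_filter mem_rem_uniq // !inE => /and3P[/eqP kj kk0 kr].
  split; first exact: gF.
  (* Equal eigenvalues force equal exponents of [w], hence equal first indices; the second indices
     are both [j]. *)
  apply: contra_neq kk0 => e; have [_ hk _] := hh k kr; have [_ hk0 _] := hh k0 k0r.
  have {}e : Q ^+ (n' + (h k).2) = Q ^+ (n' + (h k0).2).
    by move: e; case: (j) => _ //; rewrite !exprVn => /invr_inj.
  have := @expz_inj (n' + (h k).2)%N (n' + (h k0).2)%N e; move: hk hk0 kj.
  rewrite /j; case: (k) (k0) => [a1 b1] [a2 b2] /= hk hk0 kj [e']; congr (_, _); lia.
- by rewrite big_map big_filter; move: In'; rewrite (big_rem k0) //= eqxx.
(* What is left is [c k0] times a monomial. The ideal of the [u] with [c k0 * u] in [I] is again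
   saturated, and it contains this monomial, hence 1. *)
have hJ := tsideal_quot_central hI (hc k0).
have zJ : saturated z [set u | I (c k0 * u)].
  by move=> u /=; rewrite mulrA hc -mulrA; apply: zI.
have [a0 _ _] := hh k0 k0r.
rewrite -[c k0]mulr1; apply: (ideal_wg hJ zJ (a := n' + (h k0).2) (b := `|j| + m) (j := j)).
have : [set u | I (c k0 * u)]
    (z ^+ (h k0).1.2 * (w ^+ (n' + (h k0).2) * b2_g j ^+ (`|j| + m))).
  apply: (tsidealZ_inv hJ a0); move: Im; rewrite /= /F !exprD /b2_m.
  by rewrite -!mulrA -scalerAl -!mulrA.
elim: (h k0).1.2 => [|d IHd]; first by rewrite mul1r.
by rewrite exprS -mulrA => /zJ.
Qed.

(** * Spanning over the central polynomials, and primes read on the centre *)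

Let Q2 : 1 - Q ^- 2 != 0.
Proof. by rewrite subr_eq0 eq_sym invr_eq1 Qn. Qed.

Lemma central_horner_alg p : central (horner_alg z p).
Proof.
move=> u; elim/poly_ind: p => [|p c IHp]; first by rewrite rmorph0 mul0r mulr0.
rewrite rmorphD rmorphM /= horner_algX horner_algC mulrDl mulrDr central_alg.
by rewrite -mulrA z_central mulrA IHp mulrA.
Qed.

Lemma b2_commr : commr_rmorph (horner_alg z) z'.
Proof. by move=> p; exact: z'_central. Qed.

(* The inner variable is sent to [z] and the outer one to [z']. *)
Local Notation sigma := (horner_morph b2_commr).

Lemma sigma_central s : central (sigma s).
Proof.
move=> u; elim/poly_ind: s => [|s c IHs]; first by rewrite rmorph0 mul0r mulr0.
rewrite rmorphD rmorphM /= horner_morphX horner_morphC mulrDl mulrDr central_horner_alg.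
by rewrite -mulrA z'_central mulrA IHs mulrA.
Qed.

Lemma sigmaZ k u : sigma k%:P%:P * u = k *: u.
Proof. by rewrite horner_morphC /= horner_algC mulr_algl. Qed.

Lemma sigma_z : sigma 'X%:P = z.
Proof. by rewrite horner_morphC /= horner_algX. Qed.

Lemma sigma_z' : sigma 'X = z'.
Proof. exact: horner_morphX. Qed.

Definition b2_span (u : A) : Prop := exists l : seq ({poly {poly K}} * (int * int)),
  u = \sum_(p <- l) sigma p.1 * (b2_f p.2.1 * b2_m p.2.2).

Lemma spanD u v : b2_span u -> b2_span v -> b2_span (u + v).
Proof. by move=> [l ->] [l' ->]; exists (l ++ l'); rewrite big_cat. Qed.

Lemma span0 : b2_span 0. Proof. by exists [::]; rewrite big_nil. Qed.

Lemma span_sigma s u : b2_span u -> b2_span (sigma s * u).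
Proof.
move=> [l ->]; exists [seq (s * p.1, p.2) | p <- l]; rewrite big_map mulr_sumr.
by apply: eq_bigr => p _; rewrite mulrA rmorphM.
Qed.

Lemma spanZ k u : b2_span u -> b2_span (k *: u).
Proof. by rewrite -sigmaZ; apply: span_sigma. Qed.

Lemma spanB u v : b2_span u -> b2_span v -> b2_span (u - v).
Proof. by move=> hu hv; rewrite -scaleN1r; apply: spanD hu (spanZ _ hv). Qed.

Lemma span_z u : b2_span u -> b2_span (z * u).
Proof. by rewrite -sigma_z; apply: span_sigma. Qed.

Lemma span_z' u : b2_span u -> b2_span (z' * u).
Proof. by rewrite -sigma_z'; apply: span_sigma. Qed.

Lemma span_fm i j : b2_span (b2_f i * b2_m j).
Proof. by exists [:: (1, (i, j))]; rewrite big_seq1 rmorph1 mul1r. Qed.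

Lemma span_mull v : (forall i j, b2_span (v * (b2_f i * b2_m j))) ->
  forall u, b2_span u -> b2_span (v * u).
Proof.
move=> hv _ [l ->]; rewrite mulr_sumr; apply: (big_ind b2_span) => [||p _].
- exact: span0.
- exact: spanD.
- by rewrite mulrA -(sigma_central _ v) -mulrA; apply: span_sigma.
Qed.

Let xtE : x * t = (1 - Q ^- 2)^-1 *: (z' - ((1 - Q^-1) * Q ^- 2) *: (w * w)).
Proof. by rewrite (b2_z' H) addrK scalerA mulVf ?scale1r. Qed.

Let txE : t * x = (1 - Q ^- 2)^-1 *: (z' - ((1 - Q^-1) * Q ^- 2) *: (w * w))
  - (1 - Q^-1) *: (w * w).
Proof. by rewrite -xtE (b2_tx H). Qed.

Let wyE : w * y = (Q - 1)^-1 *: (t - z).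
Proof. by rewrite (b2_t H) addrK scalerA mulVf ?scale1r. Qed.

Let span_w2 a b c j : b2_span (w ^+ a *
  ((b *: (z' - c *: (w * w)) * b2_m j))).
Proof.
rewrite -scalerAl -scalerAr mulrBl mulrBr; apply: spanZ; apply: spanB.
  by rewrite mulrA -z'_central -mulrA; apply: span_z'; exact: (span_fm a j).
rewrite -scalerAl -scalerAr; apply: spanZ; rewrite !mulrA -!exprSr.
exact: (span_fm a.+2 j).
Qed.

Lemma span_wtm a j : b2_span (w ^+ a * (t * b2_m j)).
Proof.
case: j => [[|n]|n]; first by rewrite mulr1; exact: (span_fm a (Negz 0)).
  2: by rewrite -exprS; exact: (span_fm a (Negz n.+1)).
rewrite /b2_m /= exprS (mulrA t) txE mulrBl mulrBr; apply: spanB.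
  exact: (@span_w2 a _ _ n).
rewrite -scalerAl -scalerAr; apply: spanZ; rewrite !mulrA -!exprSr.
exact: (span_fm a.+2 n).
Qed.

Lemma span_wxm a j : b2_span (w ^+ a * (x * b2_m j)).
Proof.
case: j => [n|n]; first by rewrite -exprS; exact: (span_fm a n.+1).
rewrite /b2_m /= exprS (mulrA x) xtE; case: n => [|n].
  exact: (@span_w2 a _ _ 0).
exact: (@span_w2 a _ _ (Negz n)).
Qed.

Lemma span_y u : b2_span u -> b2_span (y * u).
Proof.
apply: span_mull => -[[|n]|n] j; rewrite mulrA.
  by rewrite mulr1; exact: (span_fm (Negz 0) j).
2: by rewrite -exprS; exact: (span_fm (Negz n.+1) j).
(* Eliminating [w * y] between the formulas for [y * w] and [t] gives
   [y * w = (Q t - z) / (Q - 1)]. *)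
have -> : y * b2_f n.+1 = (Q - 1)^-1 *: ((Q *: t - z) * w ^+ n).
  rewrite /= exprS mulrA (b2_yw H) wyE scalerAl; congr (_ * _).
  by move: (t : A) (z : A) => t1 z1; ncring K A; field.
rewrite -scalerAl -mulrA; apply: spanZ; rewrite mulrBl.
apply: spanB; last by apply: span_z; exact: (span_fm n j).
rewrite -scalerAl mulrA (comm_exp _ (b2_tw H)) -scalerAl -mulrA.
by do 2!apply: spanZ; exact: span_wtm.
Qed.

Lemma span_yX d u : b2_span u -> b2_span (y ^+ d * u).
Proof.
move=> hu; elim: d => [|d IHd]; first by rewrite mul1r.
by rewrite exprS -mulrA; apply: span_y.
Qed.

Lemma span_w u : b2_span u -> b2_span (w * u).
Proof.
apply: span_mull => -[n|n] j; rewrite mulrA.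
  by rewrite -exprS; exact: (span_fm n.+1 j).
rewrite /= exprS mulrA wyE -!scalerAl -mulrA; apply: spanZ; rewrite mulrBl.
apply: spanB; last first.
  apply: span_z; apply: span_yX.
  by rewrite -[X in b2_span X]mul1r; exact: (span_fm 0 j).
rewrite mulrA (comm_exp n b2_ty) -scalerAl -mulrA; apply: spanZ; apply: span_yX.
by rewrite -[X in b2_span X]mul1r; exact: (@span_wtm 0).
Qed.

(** Passing [x] through a power of [w] costs a scalar. Passing it through one factor [y] leaves a
    term starting with [w], which [span_w] absorbs. *)
Lemma span_x u : b2_span u -> b2_span (x * u).
Proof.
apply: span_mull => -[n|n] j.
  rewrite mulrA (comm_exp n (b2_xw H)) -scalerAl -mulrA; apply: spanZ.
  exact: span_wxm.
rewrite /=; elim: n.+1 => [|d IHd].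
  by rewrite mul1r; have := span_wxm 0 j; rewrite mul1r.
rewrite exprS -mulrA mulrA (b2_xy H) mulrDl -scalerAl -mulrA; apply: spanD.
  by apply: spanZ; apply: span_y.
by apply: span_w; apply: span_yX; rewrite -[X in b2_span X]mul1r; exact: (span_fm 0 j).
Qed.

Lemma b2_spanP u : b2_span u.
Proof.
apply: (b2_ind H) u => [||||]; [|exact: spanD|exact: spanZ|exact: span_x|exact: span_y].
by rewrite -[1]mulr1; exact: (span_fm 0 0).
Qed.

Lemma b2_coefP u : exists (r : seq (int * int)) (c : int * int -> {poly {poly K}}),
  uniq r /\ u = \sum_(k <- r) sigma (c k) * (b2_f k.1 * b2_m k.2).
Proof.
have [l ->] := b2_spanP u.
exists (undup [seq p.2 | p <- l]), (fun k => \sum_(p <- l | p.2 == k) p.1).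
split; first exact: undup_uniq.
rewrite (partition_big_uniq (h := snd) _ (undup_uniq [seq p.2 | p <- l])).
  by apply: eq_bigr => k _; rewrite rmorph_sum mulr_suml; apply: eq_bigr => p /eqP->.
by move=> p pl; rewrite mem_undup map_f.
Qed.

Lemma central_coef_saturated I u : two_sided_ideal I -> saturated z I ->
  exists (r : seq (int * int)) (c : int * int -> {poly {poly K}}),
  u = \sum_(k <- r) sigma (c k) * (b2_f k.1 * b2_m k.2) /\
  (I u -> {in r, forall k, I (sigma (c k))}).
Proof.
move=> hI zI; have [r [c [ur uE]]] := b2_coefP u.
exists r, c; split=> // Iu; apply: (b2_coef_in hI zI ur) => [k|].
  exact: sigma_central.
by rewrite -uE.
Qed.

(** [I] is first enlarged to its saturation at [z]. The coefficients of [u] then lie in the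
    saturation, and one of them is outside [P] because [u] is. *)
Lemma center_witness I P u : two_sided_ideal I -> two_sided_ideal P ->
  I u -> ~ P u -> exists n s, I (z ^+ n * sigma s) /\ ~ P (sigma s).
Proof.
move=> hI hP Iu nPu; have hc := z_central.
have hS := saturation_ideal hc hI.
have zS : saturated z [set u | exists n, I (z ^+ n * u)].
  by move=> v [n hn]; exists n.+1; rewrite exprSr -mulrA.
have [r [c [uE hr]]] := central_coef_saturated u hS zS.
have [k kr nPk] : exists2 k, k \in r & ~ P (sigma (c k)).
  apply: contrapT => h; apply: nPu; rewrite uE.
  apply: tsideal_sum => // k kr; apply: tsidealMr => //.
  by apply: contrapT => nk; apply: h; exists k.
have [|n hn] := hr _ k kr; first by exists 0%N; rewrite mul1r.
by exists n, (c k).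
Qed.

(** If two ideals outside [P] had all their products in [P], central witnesses of both would
    multiply into [P]; the hypothesis on the trace cancels the powers of [z] and puts one witness in
    [P]. *)
Lemma prime_of_center P : two_sided_ideal P -> ~ P 1 -> ~ P z ->
  (forall s s', P (sigma (s * s')) -> P (sigma s) \/ P (sigma s')) -> prime_ideal P.
Proof.
move=> hP nP1 nPz hp; split=> // [PT|I J hI hJ IJ]; first by rewrite PT in nP1; apply: nP1.
apply: contrapT => /not_orP[/existsNP[u /not_implyP[Iu nPu]]].
move=> /existsNP[v /not_implyP[Jv nPv]].
have [n [s [Is nPs]]] := center_witness hI hP Iu nPu.
have [m [s' [Js' nPs']]] := center_witness hJ hP Jv nPv.
have : P (sigma ('X%:P ^+ n * s * ('X%:P ^+ m * s'))).
  rewrite !rmorphM !rmorphXn /= sigma_z; apply: IJ.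
  by exists (z ^+ n * sigma s) => //; exists (z ^+ m * sigma s').
have nX k s0 : P (sigma ('X%:P ^+ k * s0)) -> P (sigma s0).
  elim: k => [|k IHk]; first by rewrite mul1r.
  by rewrite exprS -mulrA => /hp[|//]; rewrite sigma_z.
by move=> /hp[/nX|/nX].
Qed.

Lemma prime_saturated P : prime_ideal P -> ~ P z -> saturated z P.
Proof. by move=> pP nPz u Pzu; case: (prime_central pP z_central Pzu). Qed.

(** Every element of [P] is a combination of central coefficients that lie in [P]. So two primes
    avoiding [z] coincide when their traces do. *)
Lemma prime_sub_center P I : prime_ideal P -> ~ P z -> two_sided_ideal I ->
  (forall s, P (sigma s) -> I (sigma s)) -> P `<=` I.
Proof.
move=> pP nPz hI PI u Pu; have [hP _ _] := pP.
have [r [c [uE hr]]] := central_coef_saturated u hP (prime_saturated pP nPz).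
rewrite uE; apply: tsideal_sum => // k kr; apply: tsidealMr => //; exact: PI (hr Pu k kr).
Qed.

End B2System.

(** * Representations of U *)

(* Mathematical Components only bundles endomorphism rings of finite
   dimensional spaces. *)
Section Endomorphisms.
Variable K : fieldType.
Local Notation V := (int -> K^o).

Record endo := Endo { endo_fun :> V -> V; endo_linear : linear endo_fun }.

Lemma endoP (f g : endo) : (forall v i, f v i = g v i) -> f = g.
Proof.
case: f g => f hf [g hg] /= fg; have {}fg : f = g.
  by apply/funext => v; apply/funext => i.
by case: _ / fg hg => hg; congr Endo; exact: Prop_irrelevance.
Qed.

HB.instance Definition _ := gen_eqMixin endo.
HB.instance Definition _ := gen_choiceMixin endo.

Lemma endo0_linear : linear (fun _ : V => 0 : V).
Proof. by move=> k u v; rewrite scaler0 addr0. Qed.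
Lemma endoN_linear (f : endo) : linear (fun v => - f v : V).
Proof. by move=> k u v; rewrite endo_linear opprD scalerN. Qed.
Lemma endoD_linear (f g : endo) : linear (fun v => f v + g v : V).
Proof. by move=> k u v; rewrite !endo_linear scalerDr addrACA. Qed.
Lemma endo1_linear : linear (fun v : V => v).
Proof. by []. Qed.
Lemma endoM_linear (f g : endo) : linear (fun v => f (g v) : V).
Proof. by move=> k u v; rewrite !endo_linear. Qed.
Lemma endoZ_linear c (f : endo) : linear (fun v => c *: f v : V).
Proof. by move=> k u v; rewrite endo_linear scalerDr !scalerA mulrC. Qed.

Definition endo0 := Endo endo0_linear.
Definition endoN f := Endo (endoN_linear f).
Definition endoD f g := Endo (endoD_linear f g).
Definition endo1 := Endo endo1_linear.
Definition endoM f g := Endo (endoM_linear f g).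
Definition endoZ c f := Endo (endoZ_linear c f).

Lemma endoDA : associative endoD.
Proof. by move=> f g h; apply: endoP => v i /=; rewrite addrA. Qed.
Lemma endoDC : commutative endoD.
Proof. by move=> f g; apply: endoP => v i /=; rewrite addrC. Qed.
Lemma endo0D : left_id endo0 endoD.
Proof. by move=> f; apply: endoP => v i /=; rewrite add0r. Qed.
Lemma endoND : left_inverse endo0 endoN endoD.
Proof. by move=> f; apply: endoP => v i /=; rewrite addNr. Qed.

HB.instance Definition _ := GRing.isZmodule.Build endo endoDA endoDC endo0D endoND.

Lemma endoMA : associative endoM. Proof. by move=> f g h; apply: endoP. Qed.
Lemma endo1M : left_id endo1 endoM. Proof. by move=> f; apply: endoP. Qed.
Lemma endoM1 : right_id endo1 endoM. Proof. by move=> f; apply: endoP. Qed.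
Lemma endoMDl : left_distributive endoM +%R.
Proof. by move=> f g h; apply: endoP. Qed.
Lemma endoMDr : right_distributive endoM +%R.
Proof.
move=> f g h; apply: endoP => v i /=.
by have := endo_linear f 1 (g v) (h v); rewrite !scale1r => ->.
Qed.
Lemma endo1_neq0 : endo1 != 0.
Proof.
apply/eqP => /(congr1 (fun f : endo => f (fun=> 1) 0)) /= /eqP.
by rewrite oner_eq0.
Qed.

HB.instance Definition _ := GRing.Zmodule_isNzRing.Build endo
  endoMA endo1M endoM1 endoMDl endoMDr endo1_neq0.

Lemma endoZA a b f : endoZ a (endoZ b f) = endoZ (a * b) f.
Proof. by apply: endoP => v i /=; rewrite scalerA. Qed.
Lemma endo1Z : left_id 1 endoZ.
Proof. by move=> f; apply: endoP => v i /=; rewrite scale1r. Qed.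
Lemma endoZDr : right_distributive endoZ +%R.
Proof. by move=> k f g; apply: endoP => v i /=; rewrite scalerDr. Qed.
Lemma endoZDl f : {morph endoZ^~ f : a b / a + b}.
Proof. by move=> a b; apply: endoP => v i /=; rewrite scalerDl. Qed.

HB.instance Definition _ := GRing.Zmodule_isLmodule.Build K endo
  endoZA endo1Z endoZDr endoZDl.

Lemma endo_scaleAl (k : K) (f g : endo) : k *: (f * g) = (k *: f) * g.
Proof. exact: endoP. Qed.
HB.instance Definition _ := GRing.Lmodule_isLalgebra.Build K endo endo_scaleAl.

Lemma endo_scaleAr (k : K) (f g : endo) : k *: (f * g) = f * (k *: g).
Proof.
apply: endoP => v i; have h0 : f 0 = 0.
  by have := endo_linear f (-1) 0 0; rewrite scaler0 addr0 scaleN1r addNr.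
by have /= := endo_linear f k (g v) 0; rewrite h0 !addr0 => ->.
Qed.
HB.instance Definition _ := GRing.Lalgebra_isAlgebra.Build K endo endo_scaleAr.

End Endomorphisms.

(* A representation in which [z] and [z'] act as the scalars [a] and [b]: [e1]
   shifts, [e3] is diagonal with eigenvalues [Q ^ j], and [e2] is determined by
   the formulas for [z] and [z']. *)
Section Representation.
Variables (K : fieldType) (q : K).
Hypothesis q0 : q != 0.
Hypothesis Qn : forall n : nat, (q ^+ 2) ^+ n.+1 != 1.
Local Notation Q := (q ^+ 2).
Variables a b : K.
Local Notation V := (int -> K^o).

(** [t] is to act by [(t v) j = c j * v (j + 1)]. The formula for [z'] in terms of [x * t] and
    [w * w], with [z'] acting as [b], forces this value. *)
Let c (j : int) : K := (b - (1 - Q^-1) * (Q ^ j) ^+ 2) / (1 - Q ^- 2).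

Definition rep_x_fun (v : V) : V := fun j => v (j - 1).
(** Obtained by solving [w * y = (t - z) / (Q - 1)] for [y], with [w] diagonal and [z] acting as
    [a]. *)
Definition rep_y_fun (v : V) : V :=
  fun j => (Q ^ j)^-1 * (c j * v (j + 1) - a * v j) / (Q - 1).

Lemma rep_x_linear : linear rep_x_fun. Proof. by []. Qed.
Lemma rep_y_linear : linear rep_y_fun.
Proof.
move=> k u v; apply/funext => j; rewrite /rep_y_fun.
rewrite -[(k *: u + v) (j + 1)]/(k * u (j + 1) + v (j + 1)).
rewrite -[(k *: u + v) j]/(k * u j + v j).
rewrite -[RHS]/(k * ((Q ^ j)^-1 * (c j * u (j + 1) - a * u j) / (Q - 1))
  + (Q ^ j)^-1 * (c j * v (j + 1) - a * v j) / (Q - 1)).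
by move: (u j) (u (j + 1)) (v j) (v (j + 1)) => *; ring.
Qed.

Definition rep_x : endo K := Endo rep_x_linear.
Definition rep_y : endo K := Endo rep_y_linear.

Let Q0 : Q != 0. Proof. exact: expf_neq0. Qed.
Let Q1 : Q - 1 != 0. Proof. by rewrite subr_eq0; have := Qn 0; rewrite expr1. Qed.
Let Q2 : Q ^+ 2 - 1 != 0. Proof. by rewrite subr_eq0. Qed.

Let QD1 j : Q ^ (j + 1) = Q * Q ^ j.
Proof. by rewrite expfzDr // expr1z mulrC. Qed.
Let QB1 j : Q ^ (j - 1) = Q^-1 * Q ^ j.
Proof. by rewrite expfzDr // exprN1 mulrC. Qed.

Definition rep_w : endo K := rep_x * rep_y - Q *: (rep_y * rep_x).

Lemma rep_wE v j : rep_w v j = Q ^ j * v j.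
Proof.
rewrite -[LHS]/(rep_y_fun v (j - 1) - Q * rep_y_fun (rep_x_fun v) j).
rewrite /rep_y_fun /rep_x_fun /c !subrK !addrK QB1.
have := expfz_neq0 j Q0; move: (Q ^ j) (v j) (v (j - 1)) => s v0 v1 s0.
by field; rewrite Q1 q0 Q2 s0.
Qed.

Lemma rep_z : rep_y * rep_w - Q *: (rep_w * rep_y) = a%:A.
Proof.
apply: endoP => v j.
rewrite -[LHS]/(rep_y_fun (rep_w v) j - Q * rep_w (rep_y v) j) -[RHS]/(a * v j).
rewrite /rep_y_fun !rep_wE -[rep_y v j]/(rep_y_fun v j) /rep_y_fun QD1.
have := expfz_neq0 j Q0; move: (Q ^ j) (v j) (v (j + 1)) (c j) => s v0 v1 cj s0.
by field; rewrite Q1 s0.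
Qed.

Lemma rep_theta v j : (rep_y * rep_w - rep_w * rep_y) v j = c j * v (j + 1).
Proof.
rewrite -[LHS]/(rep_y_fun (rep_w v) j - rep_w (rep_y v) j).
rewrite /rep_y_fun !rep_wE -[rep_y v j]/(rep_y_fun v j) /rep_y_fun QD1.
have := expfz_neq0 j Q0; move: (Q ^ j) (v j) (v (j + 1)) (c j) => s v0 v1 cj s0.
by field; rewrite Q1 s0.
Qed.

(** The computation of [rel_xw] read backwards: the relation between [x] and the diagonal [w] is the
    first Serre relation. *)
Lemma rep_serre12 : serre12 q rep_x rep_y = 0.
Proof.
have : rep_x * rep_w = Q^-1 *: (rep_w * rep_x).
  apply: endoP => v j; rewrite -[LHS]/(rep_w v (j - 1)).
  rewrite -[RHS]/(Q^-1 * rep_w (rep_x v) j) !rep_wE QB1.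
  by rewrite -[rep_x v j]/(v (j - 1)) mulrA.
move=> /eqP; rewrite -subr_eq0 => /eqP <-.
by rewrite /serre12 /rep_w; ncring K (endo K); field.
Qed.

(** Likewise [rel_yz] read backwards: [z] acts as a scalar, so it commutes with [y]. *)
Lemma rep_serre21 : serre21 q rep_x rep_y = 0.
Proof.
have zE := rep_z; have zy : a%:A * rep_y = rep_y * a%:A by rewrite mulr_algl mulr_algr.
transitivity (Q^-1 *: (a%:A * rep_y - rep_y * a%:A)); last by rewrite zy subrr scaler0.
by rewrite -zE /serre21 /rep_w; ncring K (endo K); field.
Qed.

Definition Uq_rep : Uq q -> endo K := Uq_lift rep_x rep_y.

HB.instance Definition _ := GRing.isZmodMorphism.Build (Uq q) (endo K) Uq_rep
  (Uq_lift_zmod rep_serre12 rep_serre21).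
HB.instance Definition _ := GRing.isMonoidMorphism.Build (Uq q) (endo K) Uq_rep
  (Uq_lift_monoid rep_serre12 rep_serre21).

Lemma Uq_repZ k u : Uq_rep (k *: u) = k *: Uq_rep u.
Proof. exact: (Uq_lift_scalable rep_serre12 rep_serre21). Qed.

Lemma Uq_rep_e1 : Uq_rep (Uq_e1 q) = rep_x.
Proof. exact: Uq_lift_e1 rep_serre12 rep_serre21. Qed.

Lemma Uq_rep_e2 : Uq_rep (Uq_e2 q) = rep_y.
Proof. exact: Uq_lift_e2 rep_serre12 rep_serre21. Qed.

Lemma Uq_rep_e3 : Uq_rep (Uq_e3 q) = rep_w.
Proof. by rewrite raddfB /= Uq_repZ !rmorphM /= Uq_rep_e1 Uq_rep_e2. Qed.

Lemma Uq_rep_z : Uq_rep (Uq_z q) = a%:A.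
Proof. by rewrite raddfB /= Uq_repZ !rmorphM /= Uq_rep_e2 Uq_rep_e3 rep_z. Qed.

Lemma Uq_rep_z' : Uq_rep (Uq_z' q) = b%:A.
Proof.
have thE : Uq_rep (Uq_theta q) = rep_y * rep_w - rep_w * rep_y.
  by rewrite raddfB /= !rmorphM /= Uq_rep_e2 Uq_rep_e3.
rewrite (b2_z' (Uq_b2_system q0)) raddfD /= !Uq_repZ !rmorphM /= thE.
rewrite Uq_rep_e1 Uq_rep_e3; apply: endoP => v j.
rewrite -[RHS]/(b * v j) -[LHS]/((1 - Q ^- 2) * ((rep_y * rep_w - rep_w * rep_y) v (j - 1))
  + ((1 - Q^-1) * Q ^- 2) * (rep_w (rep_w v) j)).
rewrite rep_theta subrK !rep_wE /c QB1.
by move: (Q ^ j) (v j) => s v0; field; rewrite q0 Q2.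
Qed.

Local Notation sigma := (horner_morph (b2_commr (Uq_b2_system q0))).

Lemma Uq_rep_horner_alg p : Uq_rep (horner_alg (Uq_z q) p) = p.[a]%:A.
Proof.
elim/poly_ind: p => [|p d IHp]; first by rewrite !rmorph0 horner0 scale0r.
rewrite rmorphD rmorphM /= horner_algX horner_algC raddfD /= rmorphM /= IHp Uq_rep_z.
by rewrite Uq_repZ rmorph1 hornerMXaddC scalerDl mulr_algl scalerA.
Qed.

Lemma Uq_rep_sigma s : Uq_rep (sigma s) = s.[b%:P].[a]%:A.
Proof.
elim/poly_ind: s => [|s d IHs]; first by rewrite !rmorph0 horner0 horner0 scale0r.
rewrite rmorphD rmorphM /= horner_morphX horner_morphC raddfD /= rmorphM /= IHs Uq_rep_z'.
rewrite Uq_rep_horner_alg hornerMXaddC hornerD hornerM hornerC scalerDl.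
by rewrite mulr_algl scalerA.
Qed.

Lemma Uq_rep_zB d : Uq_rep (Uq_z q - d%:A) = (a - d)%:A.
Proof. by rewrite raddfB /= Uq_repZ rmorph1 Uq_rep_z scalerBl. Qed.

(** The kernel of the representation is a two-sided ideal containing [S], and [sigma s] acts by the
    value of [s] at the point where [z] is [a] and [z'] is [b]. *)
Lemma center_ideal_gen (S : set (Uq q)) s : (forall u, S u -> Uq_rep u = 0) ->
  ideal_gen S (sigma s) -> s.[b%:P].[a] = 0.
Proof.
move=> S0 Ss; have : Uq_rep (sigma s) = 0.
  apply: (Ss [set u | Uq_rep u = 0]); split=> //; split=> /= [|u v hu hv|u v u' hv].
  - exact: raddf0.
  - by rewrite raddfD /= hu hv addr0.
  - by rewrite !rmorphM /= hv mulr0 mul0r.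
by rewrite Uq_rep_sigma => /eqP; rewrite scaler_eq0 oner_eq0 orbF => /eqP.
Qed.

End Representation.

(** * Prime ideals of polynomial rings in two variables *)

Section CommutativePrimes.
Variable R : comNzRingType.

Definition comm_prime (p : set R) : Prop :=
  [/\ forall s s', p s -> p s' -> p (s + s'), forall s s', p s -> p (s' * s),
      ~ p 1 & forall s s', p (s * s') -> p s \/ p s'].

Lemma comm_primeB p s s' : comm_prime p -> p s -> p s' -> p (s - s').
Proof. by move=> [pD pM _ _] ps ps'; apply: pD => //; rewrite -mulN1r; apply: pM. Qed.

Lemma comm_primeX p s n : comm_prime p -> p (s ^+ n) -> p s.
Proof.
move=> [pD pM p1 pp]; elim: n => [//|n IHn]; rewrite exprS => /pp[//|]; exact: IHn.
Qed.

Lemma comm_prime_minimal (P : set {poly R}) s : P s -> s != 0 ->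
  exists2 r, P r /\ r != 0 & forall r', P r' -> r' != 0 -> (size r <= size r')%N.
Proof.
have [n] := ubnP (size s); elim: n s => // n IHn s sn Ps s0.
have [[r [Pr r0 rs]]|h] := pselect (exists r, [/\ P r, r != 0 & (size r < size s)%N]).
  by apply: (IHn r) => //; apply: leq_trans rs _.
exists s => // r Pr r0; rewrite leqNgt; apply/negP => rs; apply: h.
by exists r.
Qed.

End CommutativePrimes.

Section TwoVariables.
Variable K : fieldType.
Implicit Types (p : set {poly {poly K}}) (s : {poly {poly K}}) (c : {poly K}).

(** Division by the inner variable minus [a], one outer coefficient at a time. *)
Lemma poly2_factor (a : K) s : exists s',
  s = ('X - a%:P)%:P * s' + map_poly polyC (map_poly (horner_eval a) s).
Proof.
elim/poly_ind: s => [|s c [s' sE]]; first by exists 0; rewrite mulr0 add0r !rmorph0.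
have /factor_theorem[c' cE] : root (c - (c.[a])%:P) a.
  by rewrite /root !hornerE subrr.
exists (s' * 'X + c'%:P).
have cP : c%:P = ('X - a%:P)%:P * c'%:P + (c.[a])%:P%:P.
  by rewrite -polyCM -polyCD mulrC -cE subrK.
rewrite !rmorphD !rmorphM /= !map_polyX !map_polyC /= /horner_eval {1}cP {1}sE.
set u := map_poly _ _; ring.
Qed.

(** Otherwise a nonzero [r] of least outer degree in [p2] has positive degree. Pseudo-division by
    [r] of a minimal [f'] of [p1] leaves a quotient too small for [p1], so [r] is in [p1];
    pseudo-division of [g] then puts [g] in [p1]. *)
Lemma elimination p1 p2 f g : comm_prime p1 -> comm_prime p2 -> p1 `<=` p2 ->
  p1 f -> f != 0 -> p2 g -> ~ p1 g -> exists2 c, c != 0 & p2 c%:P.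
Proof.
move=> pr1 pr2 p12 p1f f0 p2g np1g; apply: contrapT => h.
have [D1 M1 n1 P1] := pr1; have [D2 M2 n2 P2] := pr2.
have h2 c : p2 c%:P -> c = 0.
  by move=> pc; apply: contrapT => /eqP c0; apply: h; exists c.
have [f' [p1f' f'0] f'min] := comm_prime_minimal p1f f0.
(* If the minimal [r] had positive degree in the outer variable, it would divide,
   up to powers of its leading coefficient, both [f'] and [g]. *)
have [r [p2r r0] rmin] := comm_prime_minimal (p12 _ p1f) f0.
have rdiv s : p2 s -> exists k s', (lead_coef r ^+ k)%:P * s = s' * r.
  move=> p2s; exists (scalp s r), (s %/ r).
  have E := Pdiv.Idomain.divp_eq s r.
  have [r's|r's] := eqVneq (s %% r) 0; first by rewrite mul_polyC E r's addr0.
  have : p2 (s %% r).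
    have -> : s %% r = lead_coef r ^+ scalp s r *: s - s %/ r * r by rewrite E addrC addKr.
    by apply: comm_primeB => //; [rewrite -mul_polyC|]; exact: M2.
  by move=> /rmin /(_ r's); rewrite leqNgt ltn_modpN0.
have sr : (1 < size r)%N.
  rewrite ltnNge; apply/negP => /size1_polyC rE; move: r0; rewrite rE.
  by rewrite (h2 r`_0) ?eqxx // -rE.
have nlc k : ~ p1 (lead_coef r ^+ k)%:P.
  by move=> /p12/h2/eqP; rewrite expf_eq0 lead_coef_eq0 (negPf r0) andbF.
have [k [s' E]] := rdiv _ (p12 _ p1f').
have /P1[p1s'|p1r] : p1 (s' * r) by rewrite -E; exact: M1.
  have s'0 : s' != 0.
    apply: contraTneq f'0 => s'0; move/eqP: E; rewrite s'0 mul0r mulf_eq0 polyC_eq0.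
    by rewrite expf_eq0 lead_coef_eq0 (negPf r0) andbF negbK.
  have := f'min _ p1s' s'0.
  have := congr1 (fun s => size s) E; rewrite mul_polyC size_scale; last first.
    by rewrite expf_eq0 lead_coef_eq0 (negPf r0) andbF.
  rewrite size_mul // => ->; case: (size r) sr => [|[|b]] // _.
  by rewrite !addnS /= ltnNge leq_addr.
have [k' [s'' E']] := rdiv _ p2g.
have /P1[] : p1 ((lead_coef r ^+ k')%:P * g) by rewrite E'; exact: M1.
  exact: nlc.
exact: np1g.
Qed.

(** In [c = c' * ('X - a) ^+ m] with [c'] nonzero at [a], the factor [c'] is not in [p], so the
    power is. *)
Lemma prime_root p a c : comm_prime p -> c != 0 -> p c%:P ->
  (forall c', p c'%:P -> c'.[a] = 0) -> p ('X - a%:P)%:P.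
Proof.
move=> pp c0 pc pa; have [m [c']] := multiplicity_XsubC c a; rewrite c0 /= => c'a cE.
have [_ _ _ P] := pp; move: pc; rewrite cE rmorphM rmorphXn /= => /P[/pa|].
  by move/eqP; rewrite -rootE (negPf c'a).
exact: comm_primeX.
Qed.

(** Elimination and [prime_root] give the first membership. Reducing modulo ['X - a] an element of
    [p2] that survives this reduction leaves a nonzero polynomial in the outer variable, to which
    the same factorisation argument applies at 0. *)
Lemma two_variable_primes p1 p2 a f g : comm_prime p1 -> comm_prime p2 -> p1 `<=` p2 ->
  p1 f -> f != 0 -> p2 g -> ~ p1 g -> (forall s, p2 s -> s.[0].[a] = 0) ->
  p2 ('X - a%:P)%:P /\ p2 'X.
Proof.
move=> pr1 pr2 p12 p1f f0 p2g np1g p2a.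
have [D1 M1 n1 P1] := pr1; have [D2 M2 n2 P2] := pr2.
have [c c0 p2c] := elimination pr1 pr2 p12 p1f f0 p2g np1g.
have p2X : p2 ('X - a%:P)%:P.
  by apply: prime_root c0 p2c _ => // c' /p2a; rewrite hornerC.
split=> //; pose ev s := map_poly (horner_eval a) s.
have [h p2h h0] : exists2 h, p2 h & ev h != 0.
  have [p1X|np1X] := pselect (p1 ('X - a%:P)%:P).
    exists g => //; apply/eqP => g0; apply: np1g.
    by have [g' ->] := poly2_factor a g; rewrite -/(ev g) g0 rmorph0 addr0 mulrC; apply: M1.
  (* Dividing [f] by the inner ['X - a] stays in [p1] by primality and lowers the degree of the
     leading coefficient, so some quotient survives the reduction. *)
  have [n] := ubnP (size (lead_coef f)); elim: n f p1f f0 => // n IHn f p1f f0 sf.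
  have [e0|e0] := eqVneq (ev f) 0; last by exists f => //; apply: p12.
  have [f' fE] := poly2_factor a f; rewrite -/(ev f) e0 rmorph0 addr0 in fE.
  have f'0 : f' != 0 by apply: contraNneq f0 => f'0; rewrite fE f'0 mulr0.
  apply: (IHn f') => //; first by move: p1f; rewrite fE => /P1[].
  move: sf; rewrite fE lead_coefM lead_coefC.
  by rewrite size_mul ?polyXsubC_eq0 ?lead_coef_eq0 // size_XsubC.
have {p2h h0} [e e0 p2e] : exists2 e : {poly K}, e != 0 & p2 (map_poly polyC e).
  exists (ev h) => //; have [h' hE] := poly2_factor a h.
  have -> : map_poly polyC (ev h) = h - ('X - a%:P)%:P * h'.
    by apply/eqP; rewrite eq_sym subr_eq addrC; apply/eqP.
  by apply: comm_primeB => //; rewrite mulrC; apply: M2.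
have [m [e']] := multiplicity_XsubC e 0; rewrite e0 /= subr0 => e'0 eE.
move: p2e; rewrite eE rmorphM rmorphXn /= map_polyX => /P2[/p2a|]; last exact: comm_primeX.
by rewrite -(rmorph0 polyC) horner_map hornerC => /eqP; rewrite -rootE (negPf e'0).
Qed.

End TwoVariables.

Lemma poly_eq0_inj (R : idomainType) (e : nat -> R) (p : {poly R}) :
  injective e -> (forall i, p.[e i] = 0) -> p = 0.
Proof.
move=> e_inj pe; apply/eqP; apply: contraT => p0.
have := max_poly_roots p0 (rs := map e (iota 0 (size p))).
rewrite (map_inj_uniq e_inj) iota_uniq size_map size_iota ltnn => -> //.
by apply/allP => _ /mapP[i _ ->]; rewrite /root pe.
Qed.

(** * The stratum of <z'> *)

Section Spectrum.
Variables (K : closedFieldType) (q : K).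
Hypothesis q0 : q != 0.
Hypothesis qn : forall n, (0 < n)%N -> ~~ n.-unity_root q.
Local Notation Q := (q ^+ 2).
Local Notation U := (Uq q).
Local Notation z := (Uq_z q).
Local Notation z' := (Uq_z' q).
Local Notation Zideal := (ideal_gen [set z']).
Local Notation Mideal al := (ideal_gen [set z - al%:A; z']).
Let H := Uq_b2_system q0.
Local Notation sigma := (horner_morph (b2_commr H)).

Let Q0 : Q != 0. Proof. exact: expf_neq0. Qed.
Let Qn n : Q ^+ n.+1 != 1.
Proof.
rewrite -exprM -subr_eq0; have := @qn (2 * n.+1)%N isT.
by rewrite /root_of_unity /root !hornerE.
Qed.

Let QX_inj : injective (fun i => Q ^+ i).
Proof. by move=> i j e; have [] := @expz_inj _ _ Q0 Qn (Posz i) (Posz j) e. Qed.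

Lemma poly_eq0_units (p : {poly K}) : (forall a, a != 0 -> p.[a] = 0) -> p = 0.
Proof. by move=> pa; apply: (poly_eq0_inj QX_inj) => i; apply: pa; rewrite expf_neq0. Qed.

Lemma sub_ideal_gen (A : nzRingType) (S I : set A) : two_sided_ideal I ->
  S `<=` I -> ideal_gen S `<=` I.
Proof. by move=> hI SI u; apply. Qed.

Lemma mem_ideal_gen (A : nzRingType) (S : set A) : S `<=` ideal_gen S.
Proof. by move=> u Su I [_]; apply. Qed.

(** * Traces of the ideals on the centre, and their primeness *)

Let Zid : two_sided_ideal Zideal := ideal_gen_ideal _.
Let Mid al : two_sided_ideal (Mideal al) := ideal_gen_ideal _.

Lemma Zideal_z' : Zideal z'. Proof. exact: mem_ideal_gen. Qed.
Lemma Mideal_z' al : Mideal al z'. Proof. by apply: mem_ideal_gen; right. Qed.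
Lemma Mideal_z al : Mideal al (z - al%:A). Proof. by apply: mem_ideal_gen; left. Qed.

Lemma poly_split0 (R : comNzRingType) (s : {poly R}) : exists s', s = s' * 'X + s.[0]%:P.
Proof.
have /factor_theorem[s' sE] : root (s - (s.[0])%:P) 0 by rewrite /root !hornerE subrr.
by exists s'; rewrite -['X]subr0 -polyC0 -sE subrK.
Qed.

(** So [z] and [z'] are algebraically independent: [s] vanishes at all points [(a, Q ^+ i)], and the
    powers of [Q] are infinitely many. *)
Lemma sigma_eq0 s : sigma s = 0 -> s = 0.
Proof.
move=> s0; have e_inj : injective (fun i => (Q ^+ i)%:P) by move=> i j /polyC_inj/QX_inj.
apply: (poly_eq0_inj e_inj) => i; apply: poly_eq0_units => a _.
apply: (@center_ideal_gen _ _ q0 Qn a (Q ^+ i) set0) => //.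
by rewrite s0; case: (ideal_gen_ideal (@set0 U)).
Qed.

(** Representations with [b = 0] kill [z'] and leave [a] free, so the restriction of [s] to [z' = 0]
    vanishes identically. Conversely such an [s] is divisible by the outer variable. *)
Lemma Zideal_sigma s : Zideal (sigma s) <-> s.[0] = 0.
Proof.
split=> [Zs|s0].
  apply: poly_eq0_units => a _; rewrite -polyC0.
  by apply: (@center_ideal_gen _ _ q0 Qn a 0 [set z']) => // u ->; rewrite Uq_rep_z' ?scale0r.
have [s' ->] := poly_split0 s; rewrite s0 addr0 rmorphM /= (sigma_z' H).
exact: tsidealMl Zideal_z'.
Qed.

Lemma sigma_zB al : sigma ('X - al%:P)%:P = z - al%:A.
Proof.
rewrite rmorphB /= rmorphB /= (sigma_z H); congr (_ - _).
by rewrite -[LHS]mulr1; exact: (sigmaZ H al 1).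
Qed.

Lemma Mideal_sigma al s : Mideal al (sigma s) <-> s.[0].[al] = 0.
Proof.
split=> [Ms|s0].
  rewrite -polyC0; apply: (@center_ideal_gen _ _ q0 Qn al 0 _ _ _ Ms) => u [->|->].
    by rewrite Uq_rep_zB ?subrr ?scale0r.
  by rewrite Uq_rep_z' ?scale0r.
have [s' ->] := poly_split0 s; rewrite rmorphD rmorphM /= (sigma_z' H).
apply: (tsidealD (Mid al)); first exact: (tsidealMl (sigma s') (Mid al) (@Mideal_z' al)).
have /factor_theorem[c ->] : root s.[0] al by rewrite /root s0.
rewrite rmorphM rmorphM /=; apply: (tsidealMl _ (Mid al)).
by have := @Mideal_z al; rewrite -sigma_zB.
Qed.

Arguments Zideal_sigma : clear implicits.
Arguments Mideal_sigma : clear implicits.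
Arguments Mideal_z : clear implicits.
Arguments Mideal_z' : clear implicits.

Lemma prime0 : prime_ideal [set 0 : U].
Proof.
apply: (@prime_of_center _ _ _ _ _ _ _ _ _ H Q0 Qn [set 0]).
- split=> [//|u v -> ->|u b v ->]; first by rewrite /= addr0.
  by rewrite /= mulr0 mul0r.
- by apply/eqP; exact: oner_neq0.
- by rewrite -(sigma_z H) => /sigma_eq0/eqP; rewrite polyC_eq0 polyX_eq0.
move=> s s' /sigma_eq0/eqP; rewrite mulf_eq0 => /orP[]/eqP->; [left|right];
  by rewrite rmorph0.
Qed.

Lemma Zideal_z : ~ Zideal z.
Proof. by rewrite -(sigma_z H) => /Zideal_sigma/eqP; rewrite hornerC polyX_eq0. Qed.

Lemma Mideal_nz al : al != 0 -> ~ Mideal al z.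
Proof.
move=> al0 Mz; have /Mideal_sigma/eqP : Mideal al (sigma 'X%:P) by rewrite (sigma_z H).
by rewrite hornerC hornerX (negPf al0).
Qed.

Lemma prime_Zideal : prime_ideal Zideal.
Proof.
apply: (@prime_of_center _ _ _ _ _ _ _ _ _ H Q0 Qn Zideal) => //.
- rewrite -(rmorph1 sigma) => /Zideal_sigma/eqP; rewrite hornerC oner_eq0 //.
- exact: Zideal_z.
move=> s s' /Zideal_sigma/eqP; rewrite hornerM mulf_eq0.
by move=> /orP[]/eqP /Zideal_sigma; [left|right].
Qed.

Lemma prime_Mideal al : al != 0 -> prime_ideal (Mideal al).
Proof.
move=> al0; apply: (@prime_of_center _ _ _ _ _ _ _ _ _ H Q0 Qn (Mideal al)) => //.
- move=> M1; have /Mideal_sigma/eqP : Mideal al (sigma 1) by rewrite rmorph1.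
  by rewrite !hornerC oner_eq0.
- exact: Mideal_nz.
move=> s s' /Mideal_sigma/eqP; rewrite !hornerM mulf_eq0.
by move=> /orP[]/eqP /Mideal_sigma; [left|right].
Qed.

Lemma prime_sub (P I : set U) : prime_ideal P -> ~ P z -> two_sided_ideal I ->
  (forall s, P (sigma s) -> I (sigma s)) -> P `<=` I.
Proof. exact: prime_sub_center. Qed.

(** * Primes containing [z'], and the height *)

Lemma center_comm_prime (P : set U) :
  prime_ideal P -> comm_prime [set s | P (sigma s)].
Proof.
move=> pP; have [hP _ _] := pP; split=> /= [s s' ps ps'|s s' ps||s s'].
- by rewrite rmorphD; exact: (tsidealD hP ps ps').
- by rewrite rmorphM; exact: (tsidealMl _ hP ps).
- by rewrite rmorph1; exact: prime_ideal_proper pP.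
- by rewrite rmorphM => /(prime_central pP (sigma_central H s)).
Qed.

(** The trace contains the outer variable and an element not divisible by it, hence a nonzero
    polynomial in [z] alone. This splits into linear factors over the closed field, and primeness
    selects one, [z - al]; [al] is nonzero because [z] is not in [P]. *)
Lemma prime_over_Zideal (P : set U) : prime_ideal P -> ~ P z -> P z' -> P <> Zideal ->
  exists2 al, al != 0 & P = Mideal al.
Proof.
move=> pP nPz Pz' PZ; have [hP _ _] := pP; have cp := center_comm_prime pP.
have [cD cM c1 cP] := cp.
have pX : P (sigma 'X) by rewrite (sigma_z' H).
have [s Ps s0] : exists2 s, P (sigma s) & s.[0] <> 0.
  apply: contrapT => h; apply: PZ; apply/seteqP; split; last first.
    by apply: sub_ideal_gen => // _ ->.
  apply: prime_sub => // s Ps; apply/Zideal_sigma.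
  by apply: contrapT => s0; apply: h; exists s.
have P0 s1 : P (sigma s1) -> P (sigma s1.[0]%:P).
  move=> Ps1; have [s' sE] := poly_split0 s1.
  have -> : s1.[0]%:P = s1 - s' * 'X by rewrite {2}sE addrC addKr.
  exact: (comm_primeB cp Ps1 (cM _ s' pX)).
have Pconst k : P (sigma k%:P%:P) -> k = 0.
  move=> Pk; apply: contrapT => /eqP k0; apply: c1; rewrite /= rmorph1.
  by apply: (tsidealZ_inv hP k0); rewrite -(sigmaZ H) mulr1.
have [al Pal] : exists al, P (sigma ('X - al%:P)%:P).
  have := P0 _ Ps; have [r sE] := closed_field_poly_normal s.[0].
  rewrite {}sE -mul_polyC polyCM => /cP [/= Pl|/= Pr].
    by move/eqP: (Pconst _ Pl); rewrite lead_coef_eq0 => /eqP.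
  elim: r Pr => [|a r IHr]; first by rewrite big_nil => /c1.
  by rewrite big_cons polyCM => /cP [/= Pa|//]; exists a.
have al0 : al != 0.
  by apply/eqP => al0; apply: nPz; move: Pal; rewrite al0 subr0 (sigma_z H).
exists al => //; apply/seteqP; split; last first.
  by apply: sub_ideal_gen => // _ [->|-> //]; rewrite -sigma_zB.
apply: prime_sub => // s1 Ps1; apply/Mideal_sigma.
(* Modulo [z'] and [z - al], both in [P], the central element reduces to its value at [(al, 0)], a
   scalar in [P]. *)
apply: Pconst; have /factor_theorem[c cE] : root (s1.[0] - (s1.[0].[al])%:P) al.
  by rewrite /root !hornerE subrr.
have -> : (s1.[0].[al])%:P%:P = s1.[0]%:P - c%:P * ('X - al%:P)%:P.
  by rewrite -polyCM -cE -polyCB opprB addrC subrK.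
exact: (comm_primeB cp (P0 _ Ps1) (cM _ c%:P Pal)).
Qed.

Lemma proper_center (P P' : set U) : prime_ideal P -> prime_ideal P' -> ~ P' z ->
  P `<` P' -> exists2 s, P' (sigma s) & ~ P (sigma s).
Proof.
move=> [hP _ _] pP' nPz [PP' nP'P]; apply: contrapT => h; apply: nP'P.
apply: prime_sub => // s P's; apply: contrapT => nPs; apply: h.
by exists s.
Qed.

Lemma prime_chain_sub (P : set U) m c k :
  prime_chain P m c -> (k <= m)%N -> c (m - k)%N `<=` P.
Proof.
move=> [_ cS cm]; elim: k => [|k IHk] km; first by rewrite subn0 cm.
have [|+ _] := cS (m - k.+1)%N; first by rewrite ltn_subrL (leq_trans _ km).
by rewrite subnSK // => h u /h; apply: IHk; apply: ltnW.
Qed.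

(** In a longer chain the last four members, indexed from the top by [m - k], have strictly
    increasing traces. [two_variable_primes] then makes the member just below the top contain both
    generators, against strictness. *)
Lemma height_le2 al (c : nat -> set U) m : al != 0 ->
  prime_chain (Mideal al) m c -> (m <= 2)%N.
Proof.
move=> al0 hc; rewrite leqNgt; apply/negP => m3.
have cM k : (k <= 2)%N -> c (m - k)%N `<=` Mideal al.
  by move=> k2; apply: prime_chain_sub hc _; apply: leq_trans (ltnW m3).
have nz k : (k <= 2)%N -> ~ c (m - k)%N z.
  by move=> k2 /(cM _ k2); exact: (Mideal_nz al0).
have [cP cS cm] := hc.
have pP k : prime_ideal (c (m - k)%N) by apply: cP; apply: leq_subr.
have cS' k : (k < 3)%N -> c (m - k.+1)%N `<` c (m - k)%N.
  move=> k3; rewrite -[in X in _ `<` X](subnSK (leq_trans k3 m3)); apply: cS.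
  by rewrite ltn_subrL (leq_trans _ m3).
have [f P1f nP0f] := proper_center (pP 3) (pP 2) (nz 2 isT) (cS' 2 isT).
have [g P2g nP1g] := proper_center (pP 2) (pP 1) (nz 1 isT) (cS' 1 isT).
have [sub12 _] := cS' 1 isT; have [_] := cS' 0 isT; rewrite subn0 cm; apply.
have f0 : f != 0.
  by apply/eqP => f0; apply: nP0f; rewrite f0 rmorph0; have [[]] := pP 3.
have [|s /(cM 1 isT)/Mideal_sigma//|/= PX PY] :=
  two_variable_primes (a := al) (center_comm_prime (pP 2))
    (center_comm_prime (pP 1)) _ P1f f0 P2g nP1g.
  by move=> s /= /sub12.
have [hP _ _] := pP 1%N.
by apply: sub_ideal_gen => // _ [->|->]; rewrite -?sigma_zB -?(sigma_z' H).
Qed.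

Lemma height_Mideal al : al != 0 -> has_height (Mideal al) 2.
Proof.
move=> al0; split=> [|m c]; last exact: height_le2.
exists (fun i => if i is 0 then [set 0] else if i is 1 then Zideal else Mideal al).
split=> // [[|[|i]] _|[|[|//]] _].
- exact: prime0.
- exact: prime_Zideal.
- exact: prime_Mideal al0.
- split=> [_ ->|/(_ z')]; first by case: Zid.
  move=> /(_ Zideal_z') /= z0; have := @sigma_eq0 'X.
  by rewrite (sigma_z' H) => /(_ z0)/eqP; rewrite polyX_eq0.
- split; first by apply: sub_ideal_gen => // _ ->; apply: Mideal_z'.
  move=> /(_ _ (Mideal_z al)); rewrite -sigma_zB.
  by move=> /Zideal_sigma/eqP; rewrite hornerC polyXsubC_eq0.
Qed.

(** * The torus action and the stratum *)

Lemma act_e3 h : Uq_act h (Uq_e3 q) = (h.1 * h.2) *: Uq_e3 q.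
Proof.
rewrite raddfB /= linearZZ !rmorphM /= Uq_act_e1 Uq_act_e2.
rewrite -!scalerAl -!scalerAr !scalerA scalerBr !scalerA.
by congr (_ *: _ - _ *: _); ring.
Qed.

Lemma act_e3bar h : Uq_act h (Uq_e3bar q) = (h.1 * h.2) *: Uq_e3bar q.
Proof.
rewrite raddfB /= linearZZ !rmorphM /= Uq_act_e1 Uq_act_e2.
rewrite -!scalerAl -!scalerAr !scalerA scalerBr !scalerA.
by congr (_ *: _ - _ *: _); ring.
Qed.

Lemma act_z h : Uq_act h z = (h.1 * h.2 ^+ 2) *: z.
Proof.
rewrite raddfB /= linearZZ !rmorphM /= act_e3 Uq_act_e2.
rewrite -!scalerAl -!scalerAr !scalerA scalerBr !scalerA.
by congr (_ *: _ - _ *: _); ring.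
Qed.

Lemma act_z' h : Uq_act h z' = (h.1 ^+ 2 * h.2 ^+ 2) *: z'.
Proof.
rewrite /Uq_z' linearZZ raddfD /= linearZZ !rmorphM /= act_z act_e3 act_e3bar Uq_act_e1.
rewrite -!scalerAl -!scalerAr !scalerA !scalerDr !scalerA.
by congr (_ *: _ + _ *: _); ring.
Qed.

Lemma act_ideal_gen (h : K * K) (S : set U) (I : set U) : two_sided_ideal I ->
  (forall u, S u -> I (Uq_act h u)) -> forall u, ideal_gen S u -> I (Uq_act h u).
Proof.
move=> hI SI u Su; apply: (Su [set u | I (Uq_act h u)]); split=> //.
split=> /= [|a b ha hb|a b c hb].
- by rewrite raddf0; case: hI.
- by rewrite raddfD /=; exact: (tsidealD hI ha hb).
- by rewrite !rmorphM /=; exact: (tsidealM _ _ hI hb).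
Qed.

Lemma act_inv (h : K * K) (u : U) : torus h -> Uq_act h (Uq_act (h.1^-1, h.2^-1) u) = u.
Proof. by move=> [h1 h2]; rewrite Uq_actM /= !mulfV // Uq_act1. Qed.

Lemma act_Zideal h u : Zideal u -> Zideal (Uq_act h u).
Proof.
apply: act_ideal_gen => // _ ->; rewrite act_z'.
exact: (tsidealZ _ Zid Zideal_z').
Qed.

Lemma Zideal_sub_act (I : set U) : Zideal `<=` I ->
  Zideal `<=` \bigcap_(h in @torus K) (@Uq_act K q h @` I).
Proof.
move=> ZI u Zu h hh; exists (Uq_act (h.1^-1, h.2^-1) u); last exact: act_inv.
by apply: ZI; apply: act_Zideal.
Qed.

(** The torus element is chosen so that [z] is scaled by [al / be], which sends [z - al] to a
    multiple of [z - be]. *)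
Lemma act_Mideal al be u : be != 0 -> Mideal al u -> Mideal be (Uq_act (al / be, 1) u).
Proof.
move=> be0; apply: act_ideal_gen => // _ [->|->]; last first.
  by rewrite act_z'; exact: (tsidealZ _ (Mid be) (Mideal_z' be)).
have E : Uq_act (al / be, 1) (al%:A : U) = al%:A by rewrite linearZZ rmorph1.
rewrite raddfB /= act_z E /= expr1n mulr1.
rewrite -{2}(divfK be0 al) -(scalerA _ be) -scalerBr.
exact: (tsidealZ _ (Mid be) (Mideal_z be)).
Qed.

(** By [b2_coef_in] the coefficients of [u] lie in every [Mideal be]; on [z' = 0] they vanish at
    infinitely many points, hence identically. *)
Lemma Mideal_inter u : (forall be, be != 0 -> Mideal be u) -> Zideal u.
Proof.
move=> Mu; have [r [c [ur uE]]] := b2_coefP H Q0 Qn u.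
rewrite uE; apply: (tsideal_sum Zid) => k kr; apply: (tsidealMr _ Zid).
apply/Zideal_sigma; apply: poly_eq0_units => be be0.
apply/Mideal_sigma; have pM := prime_Mideal be0.
apply: (b2_coef_in H Q0 Qn (Mid be) _ ur (c := fun k => sigma (c k))) kr => [|k'|].
- by apply: (@prime_saturated _ _ _ _ _ _ _ _ _ H (Mideal be)) => //; exact: (Mideal_nz be0).
- exact: sigma_central.
- by rewrite -uE; exact: Mu.
Qed.

(** A member of the stratum contains [z'], and it avoids [z]: an eigenvector of the torus in [P]
    lies in all translates of [P]. Conversely the translates of [Mideal al] reach every [Mideal be],
    whose intersection is [Zideal]. *)
Lemma Hstratum_Zideal : Hstratum Zideal =
  [set Zideal] `|` [set Mideal al | al in [set al : K | al != 0]].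
Proof.
apply/seteqP; split=> [P [pP PZ]|P].
  have [hP _ _] := pP.
  have t1 : @torus K (1, 1) by split; exact: oner_neq0.
  have Pz' : P z'.
    have : Zideal z' by exact: Zideal_z'.
    by rewrite -PZ => /(_ _ t1) [v Pv <-]; rewrite Uq_act1.
  have nPz : ~ P z.
    move=> Pz; apply: Zideal_z; rewrite -PZ => h [h1 h2].
    exists ((h.1 * h.2 ^+ 2)^-1 *: z); first exact: (tsidealZ _ hP Pz).
    rewrite linearZZ /= act_z scalerA mulVf ?scale1r //.
    by rewrite mulf_neq0 ?expf_neq0.
  have [->|PnZ] := pselect (P = Zideal); first by left.
  by have [al al0 ->] := prime_over_Zideal pP nPz Pz' PnZ; right; exists al.
move=> [->|[al al0 <-]].
  split; first exact: prime_Zideal.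
  apply/seteqP; split=> [u hu|]; last exact: Zideal_sub_act.
  have [|v Zv <-] := hu (1, 1); first by split; exact: oner_neq0.
  exact: act_Zideal.
split; first exact: prime_Mideal al0.
apply/seteqP; split=> [u hu|].
  apply: Mideal_inter => be be0.
  have [|v Mv <-] := hu (al / be, 1); last exact: act_Mideal.
  by split; rewrite ?oner_neq0 // mulf_neq0 ?invr_eq0.
apply: Zideal_sub_act; apply: sub_ideal_gen => // _ ->; exact: Mideal_z'.
Qed.

End Spectrum.

Theorem proposition2p3 (R : realType) (q : R[i]%C) (q_neq0 : q != 0)
    (q_nroot1 : forall n : nat, (0 < n)%N -> ~~ n.-unity_root q) :
  Hstratum (ideal_gen [set Uq_z' q]) =
    [set ideal_gen [set Uq_z' q]] `|`
    [set ideal_gen [set Uq_z q - alpha%:A; Uq_z' q]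
       | alpha in [set alpha : R[i]%C | alpha != 0]]
  /\ (forall alpha : R[i]%C, alpha != 0 ->
        prime_ideal (ideal_gen [set Uq_z q - alpha%:A; Uq_z' q]) /\
        has_height (ideal_gen [set Uq_z q - alpha%:A; Uq_z' q]) 2).
Proof.
split; first exact: (@Hstratum_Zideal R[i]%C q).
move=> al al0; split; first exact: (@prime_Mideal R[i]%C q).
exact: (@height_Mideal R[i]%C q).
Qed.
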